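(* For all $0<\epsilon<1$ there is a graph $G$ on $n_0=2^{(1+o(1))\epsilon^{-2}}$ vertices (with $o(1)\to0$ as $\epsilon\to0$), which can be found by an algorithm in time $2^{(1+o(1))n_0^2/2}$, such that $\max(h_f(G),h_f(\bar G))\le \epsilon n_0$, where $\bar G$ is the complement of $G$. In particular, every complete blow-up of $G$ and its complement are $\epsilon$-Hadwiger.
   Context: The Hadwiger number $h(H)$ of a graph $H$ is the largest $t$ such that $K_t$ is a minor of $H$; a graph $H$ is $\epsilon$-Hadwiger if $h(H)\le\epsilon|V(H)|$. The complete blow-up $G[t]$ is the lexicographic product $G\cdot K_t$: vertex set $V(G)\times V(K_t)$, with $(u_1,v_1)\sim(u_2,v_2)$ iff $u_1u_2\in E(G)$, or $u_1=u_2$ and $v_1\ne v_2$. A bramble for $G$ is a collection $\mathcal B$ of connected subgraphs of $G$ such that every pair $B,B'\in\mathcal B$ either shares a vertex or is joined by an edge of $G$. The fractional Hadwiger number $h_f(G)$ is the maximum of $\sum_{B\in\mathcal B}w(B)$ over all brambles $\mathcal B$ and all $w:\mathcal B\to\mathbb R_{\ge0}$ such that for each vertex $v$, the total weight of members of $\mathcal B$ containing $v$ is at most $1$. *)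

(* Defs.v *)
From mathcomp Require Import all_boot all_order all_algebra.
From mathcomp Require Import boolp classical_sets reals topology normedtype exp.

Set Implicit Arguments.
Unset Strict Implicit.
Unset Printing Implicit Defensive.

Import Order.TTheory GRing.Theory Num.Theory.
Import numFieldNormedType.Exports.

Local Open Scope ring_scope.

(** * Graphs *)

Record sgraph (T : finType) := SGraph {
  edge :> rel T;
  edge_sym : symmetric edge;
  edge_irr : irreflexive edge }.

Section Graphs.
Variable T : finType.
Implicit Types G : sgraph T.

Definition compl_edge G : rel T := fun x y => (x != y) && ~~ G x y.

Fact compl_edge_sym G : symmetric (compl_edge G).
Proof. by move=> x y; rewrite /compl_edge eq_sym edge_sym. Qed.

Fact compl_edge_irr G : irreflexive (compl_edge G).
Proof. by move=> x; rewrite /compl_edge eqxx. Qed.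

Definition compl G := SGraph (@compl_edge_sym G) (@compl_edge_irr G).

Definition complete_edge : rel T := fun x y => x != y.

Fact complete_edge_sym : symmetric complete_edge.
Proof. by move=> x y; rewrite /complete_edge eq_sym. Qed.

Fact complete_edge_irr : irreflexive complete_edge.
Proof. by move=> x; rewrite /complete_edge eqxx. Qed.

Definition complete_graph := SGraph complete_edge_sym complete_edge_irr.

Definition blowup_edge G t : rel (T * 'I_t) :=
  fun p q => G p.1 q.1 || (p.1 == q.1) && (p.2 != q.2).

Fact blowup_edge_sym G t : symmetric (@blowup_edge G t).
Proof.
by move=> p q; rewrite /blowup_edge edge_sym (eq_sym p.1) (eq_sym p.2).
Qed.

Fact blowup_edge_irr G t : irreflexive (@blowup_edge G t).
Proof. by move=> p; rewrite /blowup_edge edge_irr !eqxx. Qed.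

Definition blowup G t := SGraph (@blowup_edge_sym G t) (@blowup_edge_irr G t).

(** A subgraph is a pair of a vertex set and an edge set; every undirected
    edge is represented by both of its orientations. *)
Definition subgraph : Type := ({set T} * {set T * T})%type.

Definition is_subgraph G (B : subgraph) : bool :=
  [forall p in B.2, [&& G p.1 p.2, p.1 \in B.1, p.2 \in B.1
                      & (p.2, p.1) \in B.2]].

(** Connected graphs are nonempty. *)
Definition connected_subgraph (B : subgraph) : bool :=
  (B.1 != finset.set0) &&
  [forall x in B.1, forall y in B.1,
     connect (fun u v => (u, v) \in B.2) x y].

Definition induced G (S : {set T}) : subgraph :=
  (S, finset (fun p : T * T => [&& G p.1 p.2, p.1 \in S & p.2 \in S])).

Definition joined G (S S' : {set T}) : bool :=
  [exists x in S, exists y in S', G x y].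

Definition bramble G (BB : {set subgraph}) : bool :=
  [forall B in BB, is_subgraph G B && connected_subgraph B] &&
  [forall B in BB, forall B' in BB,
     ~~ [disjoint B.1 & B'.1] || joined G B.1 B'.1].

Definition fractional_weighting (R : realType) (BB : {set subgraph})
    (w : subgraph -> R) : Prop :=
  (forall B, B \in BB -> 0 <= w B) /\
  (forall v : T, \sum_(B in BB | v \in B.1) w B <= 1).

Definition fhadwiger_values (R : realType) G : set R := fun r =>
  exists (BB : {set subgraph}) (w : subgraph -> R),
    [/\ bramble G BB, fractional_weighting BB w & r = \sum_(B in BB) w B].

(** The maximum is rendered as a supremum; see [has_sup_fhadwiger_values]. *)
Definition fhadwiger (R : realType) G : R := sup (@fhadwiger_values R G).

Lemma has_sup_fhadwiger_values (R : realType) G :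
  has_sup (@fhadwiger_values R G).
Proof.
split.
  exists 0, finset.set0, (fun=> 0); split; last by rewrite big_set0.
    by apply/andP; split; apply/forall_inP => B; rewrite inE.
  by split=> // v; rewrite big1.
exists #|T|%:R => _ [BB [w [/andP[/forall_inP brB _] [w0 w1] ->]]].
have -> : #|T|%:R = \sum_(v : T) (1 : R) by rewrite sumr_const.
apply: (le_trans _ (ler_sum _ (fun v _ => w1 v))).
under [leRHS]eq_bigr do rewrite big_mkcondr.
rewrite exchange_big; apply: ler_sum => B BBB.
have /andP[_ /andP[/set0Pn[x xB] _]] := brB _ BBB.
rewrite (bigD1 x) //= xB lerDl; apply: sumr_ge0 => v _.
by case: ifP => // _; exact: w0.
Qed.

End Graphs.

(** [phi] maps the vertices of [H] to their branch sets in [G]. *)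
Definition minor (U T : finType) (H : sgraph U) (G : sgraph T) : bool :=
  [exists phi : {ffun U -> {set T}},
    [&& [forall x, connected_subgraph (induced G (phi x))],
        [forall x, forall y, (x != y) ==> [disjoint phi x & phi y]]
      & [forall x, forall y, H x y ==> joined G (phi x) (phi y)]]].

(** The range [t <= #|T|] is no restriction, by [complete_minor_le]. *)
Definition hadwiger (T : finType) (G : sgraph T) : nat :=
  (\max_(t < #|T|.+1 | minor (complete_graph 'I_t) G) t)%N.

Lemma complete_minor_le (T : finType) (G : sgraph T) t :
  minor (complete_graph 'I_t) G -> (t <= #|T|)%N.
Proof.
case/existsP=> phi /and3P[/forallP cn /forallP dj _].
have ne i : exists x, x \in phi i by have /andP[/set0Pn] := cn i.
have inj : injective (fun i => xchoose (ne i)).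
  move=> i j eij; apply/eqP/negPn/negP => nij.
  have /implyP/(_ nij) /pred0P/(_ (xchoose (ne i))) := forallP (dj i) j.
  by rewrite /= {2}eij !(xchooseP (ne _)).
by rewrite -[t]card_ord; exact: leq_card inj.
Qed.

Definition eps_Hadwiger (R : realType) (e : R) (T : finType) (G : sgraph T) :
  Prop := (hadwiger G)%:R <= e * #|T|%:R.

(** * Algorithms *)

(** Programs of a successor random access machine with structured control
    flow: registers and memory cells hold natural numbers and are indexed by
    natural numbers, the only arithmetic operations are [+ 1] and [- 1], and
    each elementary command and each test takes one unit of time (so after
    [t] steps all values are at most [t] plus a constant of the program, and
    charging for the lengths of the operands would only cost a logarithmic
    factor). The input is an infinite read-only sequence of bits. *)
Inductive prog :=
| Const of nat & nat         (* r_x := c *)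
| Copy of nat & nat          (* r_x := r_y *)
| Succ of nat                (* r_x := r_x + 1 *)
| Pred of nat                (* r_x := r_x - 1, truncated *)
| Fetch of nat & nat         (* r_x := cell[r_y] *)
| Store of nat & nat         (* cell[r_x] := r_y *)
| Read of nat & nat          (* r_x := input[r_y] *)
| Seq of prog & prog
| If of nat & prog & prog    (* if r_x <> 0 then .. else .. *)
| While of nat & prog.       (* while r_x <> 0 do .. *)

Record state := State { reg : nat -> nat; cell : nat -> nat }.

Definition state0 := State (fun=> 0%N) (fun=> 0%N).

Definition set_reg (s : state) (x v : nat) :=
  State [eta reg s with x |-> v] (cell s).

Definition set_cell (s : state) (a v : nat) :=
  State (reg s) [eta cell s with a |-> v].

(** [exec inp p s t s']: run from [s] on input [inp], the program [p] halts
    in [s'] after exactly [t] units of time. *)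
Inductive exec (inp : nat -> bool) : prog -> state -> nat -> state -> Prop :=
| ExecConst x c s : exec inp (Const x c) s 1%N (set_reg s x c)
| ExecCopy x y s : exec inp (Copy x y) s 1%N (set_reg s x (reg s y))
| ExecSucc x s : exec inp (Succ x) s 1%N (set_reg s x (reg s x).+1)
| ExecPred x s : exec inp (Pred x) s 1%N (set_reg s x (reg s x).-1)
| ExecFetch x y s : exec inp (Fetch x y) s 1%N (set_reg s x (cell s (reg s y)))
| ExecStore x y s : exec inp (Store x y) s 1%N (set_cell s (reg s x) (reg s y))
| ExecRead x y s : exec inp (Read x y) s 1%N (set_reg s x (inp (reg s y)))
| ExecSeq p q s1 s2 s3 t u :
    exec inp p s1 t s2 -> exec inp q s2 u s3 ->
    exec inp (Seq p q) s1 (t + u)%N s3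
| ExecIfTrue x p q s s' t :
    reg s x != 0%N -> exec inp p s t s' -> exec inp (If x p q) s t.+1 s'
| ExecIfFalse x p q s s' t :
    reg s x = 0%N -> exec inp q s t s' -> exec inp (If x p q) s t.+1 s'
| ExecWhileDone x p s :
    reg s x = 0%N -> exec inp (While x p) s 1%N s
| ExecWhileStep x p s1 s2 s3 t u :
    reg s1 x != 0%N -> exec inp p s1 t s2 -> exec inp (While x p) s2 u s3 ->
    exec inp (While x p) s1 (t + u).+1 s3.

(** The binary expansion of [e], for [0 <= e < 1]: bit [k] has weight
    [2 ^- k.+1]. *)
Definition binary_digit (R : realType) (e : R) (k : nat) : bool :=
  odd (Num.truncn (e * 2 ^+ k.+1)).

(** The number of vertices is left in register 0, the adjacency matrix in row
    order in the memory. *)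
Definition outputs (s : state) (n : nat) (G : sgraph 'I_n) : Prop :=
  reg s 0%N = n /\ forall i j : 'I_n, cell s (i * n + j)%N = G i j.

(** From input [e], the program [p] finds [G] in [t] units of time. *)
Definition finds (R : realType) (p : prog) (e : R) (n : nat)
    (G : sgraph 'I_n) (t : nat) : Prop :=
  exists2 s, exec (binary_digit e) p state0 t s & outputs s G.

(* Main.v *)
Require Import Defs.
From mathcomp Require Import all_boot all_order all_algebra.
From mathcomp Require Import boolp classical_sets reals topology normedtype exp.
From mathcomp Require Import zify lra ring.

Set Implicit Arguments.
Unset Strict Implicit.
Unset Printing Implicit Defensive.

Import Order.TTheory GRing.Theory Num.Theory.
Import numFieldNormedType.Exports.

(** A random graph on [n = 2 ^ ((1 + o(1)) s ^ 2)] vertices, [s] close to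
    [1 / e], almost surely has no [k] disjoint sets of at most [s] vertices that
    are pairwise joined, already for [k = n / 2 ^ (3 s)]: two such sets are not
    joined with probability at least [2 ^ - s ^ 2], the [k (k - 1) / 2] events are
    independent, and there are only [n ^ (k s)] families. The same holds in the
    complement. A graph without such a family has fractional Hadwiger number at
    most [e n]: in a weighted bramble of weight more than [e n], the sets with
    more than [s] vertices weigh at most [n / (s + 1)], and each choice of a small
    set excludes weight at most [s], so the greedy choice finds [k] disjoint ones.
    Branch sets of a clique minor in a blow-up project to a bramble of the graph,
    which gives the bounds on the blow-ups.

    The machine goes through all graphs on [n] vertices with a binary counter,
    which takes [2 ^ (n (n - 1) / 2 + 1)] rounds, and tests the absence of such
    families by brute force. Each test takes time [2 ^ O(n log n)], so crude
    successor arithmetic is good enough for it. *)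

Local Open Scope nat_scope.

(** * Polynomial time computation on the machine *)

(** A context describes the data from which a function is computed: an element
    of [ctx_car] is presented to the machine by an input, by the contents of a
    few registers and by the memory; [bd] measures its size. *)
Record ctx := Ctx {
  ctx_car :> Type;
  inp : ctx_car -> nat -> bool;
  regs : ctx_car -> seq nat;
  cmem : ctx_car -> nat -> nat;
  bd : ctx_car -> nat;
  cmem_le : forall g a, cmem g a <= bd g;
  regs_le : forall g v, v \in regs g -> v <= bd g }.

(** Adjoins one number, such as a loop index, held in a further register; iterated extensions serve
    as environments for nested loops. *)
Definition ext_regs (c : ctx) (g : c * nat) := g.2 :: regs g.1.
Definition ext_bd (c : ctx) (g : c * nat) := bd g.1 + g.2.

Fact ext_mem_le (c : ctx) (g : c * nat) a : cmem g.1 a <= ext_bd g.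
Proof. exact: leq_trans (cmem_le _ _) (leq_addr _ _). Qed.

Fact ext_regs_le (c : ctx) (g : c * nat) v : v \in ext_regs g -> v <= ext_bd g.
Proof.
rewrite inE => /predU1P[->|/regs_le vg]; first exact: leq_addl.
exact: leq_trans vg (leq_addr _ _).
Qed.

Definition ext (c : ctx) : ctx :=
  @Ctx (c * nat) (fun g => inp g.1) (@ext_regs c) (fun g => cmem g.1)
    (@ext_bd c) (@ext_mem_le c) (@ext_regs_le c).

(** The base is at least 2, so that constants and sums can be absorbed into the exponent. *)
Definition pbounded (c : ctx) (F : c -> nat) :=
  exists K, forall g, F g <= (bd g).+2 ^ K.

(** [locs] lists the registers that hold [regs g]; they lie below the stack
    pointer [d]. *)
Definition holds (c : ctx) (g : c) (locs : seq nat) (d : nat) (s : state) :=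
  [/\ forall l, l \in locs -> l < d, map (reg s) locs = regs g
    & forall a, cell s a = cmem g a].

(** Registers from [d] upwards are scratch space. *)
Definition same (d : nat) (s s' : state) :=
  (forall x, x < d -> reg s' x = reg s x) /\ (forall a, cell s' a = cell s a).

Definition yields (i : nat -> bool) (p : prog) (d : nat) (s : state)
    (T v : nat) :=
  exists t s', [/\ exec i p s t s', t <= T, reg s' d = v & same d s s'].

(* The program is given the register locations and the stack pointer as
   parameters, so that it can be relocated into the body of a loop. *)
Definition ptime (c : ctx) (F : c -> nat) :=
  exists (p : seq nat -> nat -> prog) (T : c -> nat),
    [/\ pbounded F, pbounded T
      & forall g locs d s, holds g locs d s ->
          yields (inp g) (p locs d) d s (T g) (F g)].

Lemma same_trans d s2 s1 s3 : same d s1 s2 -> same d s2 s3 -> same d s1 s3.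
Proof.
by move=> [r1 c1] [r2 c2]; split=> [x xd|a]; rewrite ?r2 ?r1 ?c2 ?c1.
Qed.

Lemma same_le d d' s s' : d <= d' -> same d' s s' -> same d s s'.
Proof. by move=> dd [r cl]; split=> // x xd; apply: r; apply: leq_trans dd. Qed.

Lemma same_set_reg d s x v : d <= x -> same d s (set_reg s x v).
Proof.
by move=> dx; split=> //= y yd; rewrite ifN_eq // neq_ltn (leq_trans yd).
Qed.

Lemma reg_set s x v y : reg (set_reg s x v) y = if y == x then v else reg s y.
Proof. by []. Qed.

Lemma holds_same (c : ctx) (g : c) locs d d' s s' :
  holds g locs d s -> same d s s' -> d <= d' ->
  holds g locs d' s'.
Proof.
move=> [ld rg cg] [rs cs] dd; split=> [l /ld /leq_trans -> //||a].
  by rewrite -rg; apply/eq_in_map => l /ld /rs.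
by rewrite cs.
Qed.

Lemma holds_ext (c : ctx) (g : c) locs d l v s :
  holds g locs d s -> l < d -> reg s l = v ->
  holds ((g, v) : ext c) (l :: locs) d s.
Proof.
move=> [ld rg cg] lld rv; split=> //=; last by rewrite rg rv.
by move=> l'; rewrite inE => /predU1P[->|/ld].
Qed.

Section Ptime.
Variable c : ctx.
Implicit Types (g : c) (F : c -> nat).

Lemma pbounded_le F F' : (forall g, F g <= F' g) -> pbounded F' -> pbounded F.
Proof. by move=> le [K b]; exists K => g; exact: leq_trans (b g). Qed.

Lemma pbounded_const v : pbounded (fun _ : c => v).
Proof.
exists v => g; apply: leq_trans (ltnW (ltn_expl v (isT : 1 < 2))) _.
by case: v => // v; rewrite leq_exp2r.
Qed.

Lemma pbounded_bd : pbounded (@bd c).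
Proof. by exists 1 => g; rewrite expn1; lia. Qed.

Lemma pboundedM F F' : pbounded F -> pbounded F' ->
  pbounded (fun g => F g * F' g).
Proof. by move=> [K b] [K' b']; exists (K + K') => g; rewrite expnD leq_mul. Qed.

Lemma pboundedD F F' : pbounded F -> pbounded F' ->
  pbounded (fun g => F g + F' g).
Proof.
move=> b b'; apply: (@pbounded_le _ (fun g => (F g).+1 * (F' g).+1)).
  by move=> g; nia.
suff pS f : pbounded f -> pbounded (fun g => (f g).+1).
  by apply: pboundedM; exact: pS.
case=> K bf; exists K.+1 => g; rewrite expnS.
by have := bf g; have := expn_gt0 (bd g).+2 K; nia.
Qed.

Lemma pboundedX F k : pbounded F -> pbounded (fun g => F g ^ k).
Proof.
case=> K b; exists (K * k) => g; rewrite expnM.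
by case: k => // k; rewrite leq_exp2r.
Qed.

Lemma pbounded_ext (F : ext c -> nat) : pbounded F ->
  exists K, forall g i, F (g, i) <= ((bd g).+2 + i) ^ K.
Proof. by case=> K b; exists K => g i; apply: leq_trans (b _) _. Qed.

Lemma ptime_ext F F' : F =1 F' -> ptime F -> ptime F'.
Proof. by move=> /funext->. Qed.

Lemma ptime_bounded F : ptime F -> pbounded F.
Proof. by case=> p [T []]. Qed.

Lemma ptime_const v : ptime (fun _ : c => v).
Proof.
exists (fun _ d => Const d v), (fun=> 1); split; try exact: pbounded_const.
move=> g locs d s _; exists 1, (set_reg s d v); split=> //.
- exact: ExecConst.
- by rewrite reg_set eqxx.
- exact: same_set_reg.
Qed.

Lemma ptime_weak F : ptime F -> ptime (fun g : ext c => F g.1).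
Proof.
have pb f : pbounded f -> pbounded (fun g : ext c => f g.1).
  case=> K b; exists K => g; apply: leq_trans (b _) _.
  by case: K {b} => // K; rewrite leq_exp2r // !ltnS leq_addr.
case=> p [T [bF bT h]].
exists (fun locs => p (behead locs)), (fun g : ext c => T g.1).
split; try exact: pb.
move=> [g i] [|l locs] d s [ld //= [_ rg] cg]; apply: h; split=> //.
by move=> l' l'in; apply: ld; rewrite inE l'in orbT.
Qed.

Lemma ptime_var : ptime (fun g : ext c => g.2).
Proof.
exists (fun locs d => Copy d (head 0 locs)), (fun=> 1); split.
- by exists 1 => -[g i] /=; rewrite /ext_bd /=; lia.
- by exists 0.
move=> [g i] [|l locs] d s [ld //= [rl rg] cg].
exists 1, (set_reg s d i); split=> //.
- by rewrite -rl; exact: ExecCopy.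
- by rewrite reg_set eqxx.
- exact: same_set_reg.
Qed.

(** Covers the operations that need one instruction applied to the value just left in register
    [d]. *)
Lemma ptime_step F (H : c -> nat -> nat) (op : nat -> prog) :
  pbounded (fun g => H g (F g)) ->
  (forall g locs d s, holds g locs d s -> reg s d = F g ->
     exec (inp g) (op d) s 1 (set_reg s d (H g (F g)))) ->
  ptime F -> ptime (fun g => H g (F g)).
Proof.
move=> bH ho [p [T [bF bT h]]].
exists (fun locs d => Seq (p locs d) (op d)), (fun g => T g + 1).
split=> //; first by apply: pboundedD => //; exact: pbounded_const.
move=> g locs d s hs; have [t [s' [ex tT rd sm]]] := h _ _ _ _ hs.
exists (t + 1), (set_reg s' d (H g (F g))); split.
- by apply: ExecSeq ex _; apply: (ho g locs) => //; exact: holds_same hs sm _.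
- by rewrite leq_add2r.
- by rewrite reg_set eqxx.
- by apply: same_trans sm _; exact: same_set_reg.
Qed.

Lemma ptimeS F : ptime F -> ptime (fun g => (F g).+1).
Proof.
move=> pF; apply: (@ptime_step F (fun _ v => v.+1) Succ) => //.
  apply: (@pbounded_le _ (fun g => F g + 1)) => [g|]; first by rewrite addn1.
  by apply: pboundedD; [exact: ptime_bounded | exact: pbounded_const].
by move=> g locs d s _ <-; exact: ExecSucc.
Qed.

Lemma ptimeP F : ptime F -> ptime (fun g => (F g).-1).
Proof.
move=> pF; apply: (@ptime_step F (fun _ v => v.-1) Pred) => //.
  apply: (@pbounded_le _ F) => [g|]; first exact: leq_pred.
  exact: ptime_bounded.
by move=> g locs d s _ <-; exact: ExecPred.
Qed.

Lemma ptime_mem F : ptime F -> ptime (fun g => cmem g (F g)).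
Proof.
move=> pF; apply: (@ptime_step F (fun g v => cmem g v) (fun d => Fetch d d)) => //.
  by apply: pbounded_le pbounded_bd => g; exact: cmem_le.
by move=> g locs d s [_ _ <-] <-; exact: ExecFetch.
Qed.

Lemma ptime_inp F : ptime F -> ptime (fun g => inp g (F g)).
Proof.
move=> pF.
apply: (@ptime_step F (fun g v => inp g v : nat) (fun d => Read d d)) => //.
  by apply: pbounded_le (pbounded_const 1) => g; case: inp.
by move=> g locs d s _ <-; exact: ExecRead.
Qed.

Lemma ptime_if (P : c -> bool) F F' : ptime (fun g => P g) -> ptime F -> ptime F' ->
  ptime (fun g => if P g then F g else F' g).
Proof.
move=> [p [T [_ bT h]]] [p1 [T1 [bF1 bT1 h1]]] [p2 [T2 [bF2 bT2 h2]]].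
exists (fun locs d => Seq (p locs d) (If d (p1 locs d) (p2 locs d))).
exists (fun g => T g + (T1 g + T2 g + 1)); split.
- by apply: pbounded_le (pboundedD bF1 bF2) => g; case: ifP; lia.
- by do 3?[apply: pboundedD => //]; exact: pbounded_const.
move=> g locs d s hs; have [t [s1 [ex tT rd sm]]] := h _ _ _ _ hs.
have hs1 := holds_same hs sm (leqnn d).
case: ifP rd => Pg rd.
  have [u [s2 [ex2 uT rd2 sm2]]] := h1 _ _ _ _ hs1.
  exists (t + u.+1), s2; split=> //; last exact: same_trans sm2.
    by apply: ExecSeq ex _; apply: ExecIfTrue ex2; rewrite rd.
  lia.
have [u [s2 [ex2 uT rd2 sm2]]] := h2 _ _ _ _ hs1.
exists (t + u.+1), s2; split=> //; last exact: same_trans sm2.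
  by apply: ExecSeq ex _; apply: ExecIfFalse ex2; rewrite rd.
lia.
Qed.

(* The hypothesis on [A] is what keeps primitive recursion polynomial. *)
Lemma ptime_rec (N F0 A : c -> nat) (G : c -> nat -> nat -> nat) :
  ptime N -> ptime F0 -> ptime (fun g : ext (ext c) => G g.1.1 g.1.2 g.2) ->
  pbounded A -> (forall g i, i <= N g -> iteri i (G g) (F0 g) <= A g) ->
  ptime (fun g => iteri (N g) (G g) (F0 g)).
Proof.
move=> [pN [TN [bN bTN hN]]] [p0 [T0 [b0 bT0 h0]]] [pG [TG [bG bTG hG]]] bA leA.
(* Register [d] counts the remaining rounds, [d.+1] holds the index, [d.+2] the accumulator, and
   [d.+3] receives its new value. *)
pose body locs d :=
  Seq (pG [:: d.+2, d.+1 & locs] d.+3)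
    (Seq (Copy d.+2 d.+3) (Seq (Succ d.+1) (Pred d))).
have [K bK] := bTG.
(* Bounds every call of [pG], because the index is at most [N g] and the accumulator at most
   [A g]. *)
pose TB g := ((bd g).+2 + N g + A g) ^ K.
exists (fun locs d => Seq (pN locs d) (Seq (Const d.+1 0) (Seq (p0 locs d.+2)
  (Seq (While d (body locs d)) (Copy d d.+2))))).
exists (fun g => TN g + (1 + (T0 g + ((N g * (TB g + 4) + 1) + 1)))).
have bTB : pbounded TB.
  apply: pboundedX; do 2?[apply: pboundedD => //].
  by apply: (@pbounded_le _ (fun g => bd g + 2)) => [g|];
    [lia | apply: pboundedD; [exact: pbounded_bd | exact: pbounded_const]].
split.
- by apply: pbounded_le bA => g; exact: leA.
- by repeat first [exact: pbounded_const | assumption | apply: pboundedD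
    | apply: pboundedM].
move=> g locs d s hs.
have loop r : forall j s1, j + r = N g -> same d s s1 -> reg s1 d = r ->
    reg s1 d.+1 = j -> reg s1 d.+2 = iteri j (G g) (F0 g) ->
    exists t s2, [/\ exec (inp g) (While d (body locs d)) s1 t s2,
      t <= r * (TB g + 4) + 1, reg s2 d.+2 = iteri (N g) (G g) (F0 g)
      & same d s s2].
  elim: r => [|r IH] j s1 jr sm rd rd1 rd2.
    exists 1, s1; split=> //; first exact: ExecWhileDone.
    by rewrite rd2 -jr addn0.
  have hs1 : holds ((g, j, reg s1 d.+2) : ext (ext c))
      [:: d.+2, d.+1 & locs] d.+3 s1.
    apply: holds_ext => //; apply: holds_ext => //.
    by apply: holds_same hs sm _; lia.
  have [t [s2 [ex tT rv sm2]]] := hG _ _ _ _ hs1.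
  pose s3 := set_reg s2 d.+2 (reg s2 d.+3).
  pose s4 := set_reg s3 d.+1 (reg s3 d.+1).+1.
  pose s5 := set_reg s4 d (reg s4 d).-1.
  have ltb : t <= TB g.
    apply: leq_trans tT _; apply: leq_trans (bK _) _; rewrite /TB /= /ext_bd /=.
    have le1 : reg s1 d.+2 <= A g by rewrite rd2; apply: leA; lia.
    by case: (K) => // K'; rewrite leq_exp2r //= /ext_bd /=; lia.
  have smd x : x < d.+3 -> reg s2 x = reg s1 x by case: sm2 => h _; apply: h.
  have ex5 : exec (inp g) (body locs d) s1 (t + (1 + (1 + 1))) s5.
    apply: ExecSeq ex _; apply: ExecSeq (ExecCopy _ _ _ _) _.
    by apply: ExecSeq (ExecSucc _ _ _) (ExecPred _ _ _).
  have [|||||u [s6 [ex6 uT rv6 sm6]]] := IH j.+1 s5.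
  - lia.
  - apply: same_trans sm _; apply: same_trans (same_le _ sm2) _; first by lia.
    apply: same_trans (same_set_reg _ _ _); last by lia.
    apply: same_trans (same_set_reg _ _ _); last by lia.
    by apply: same_set_reg; lia.
  - rewrite /s5 reg_set eqxx /s4 reg_set ifN_eq; last by lia.
    by rewrite /s3 reg_set ifN_eq; [rewrite smd ?rd //; lia | lia].
  - rewrite /s5 reg_set ifN_eq; last by lia.
    rewrite /s4 reg_set eqxx /s3 reg_set ifN_eq; last by lia.
    by rewrite smd ?rd1 //; lia.
  - rewrite /s5 reg_set ifN_eq; last by lia.
    rewrite /s4 reg_set ifN_eq; last by lia.
    by rewrite /s3 reg_set eqxx rv /= rd2.
  exists (t + (1 + (1 + 1)) + u).+1, s6; split=> //; last by lia.
  by apply: ExecWhileStep ex5 ex6; rewrite rd.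
have [t1 [s1 [ex1 tT1 rv1 sm1]]] := hN _ _ _ _ hs.
pose s2 := set_reg s1 d.+1 0.
have sm2 : same d.+1 s1 s2 by exact: same_set_reg.
have hs2 : holds g locs d.+2 s2.
  apply: holds_same hs (same_trans sm1 (same_le _ sm2)) _; lia.
have [t3 [s3 [ex3 tT3 rv3 sm3]]] := h0 _ _ _ _ hs2.
have [||||u [s4 [ex4 uT rv4 sm4]]] := loop (N g) 0 s3 _ _ _ _ rv3.
- lia.
- apply: same_trans sm1 _; apply: same_trans (same_le _ sm2) (same_le _ sm3); lia.
- by rewrite sm3.1 // sm2.1.
- by rewrite sm3.1 // /s2 reg_set eqxx.
exists (t1 + (1 + (t3 + (u + 1)))), (set_reg s4 d (reg s4 d.+2)); split.
- apply: ExecSeq ex1 _; apply: ExecSeq (ExecConst _ _ _ _) _.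
  by apply: ExecSeq ex3 _; apply: ExecSeq ex4 (ExecCopy _ _ _ _).
- lia.
- by rewrite reg_set eqxx rv4.
- by apply: same_trans sm4 _; apply: same_set_reg.
Qed.

Lemma ptime_neg (P : c -> bool) : ptime (fun g => P g) -> ptime (fun g => ~~ P g).
Proof.
move=> pP; apply: (@ptime_ext (fun g => if P g then 0 else 1)) => [g|].
  by case: (P g).
by apply: ptime_if => //; exact: ptime_const.
Qed.

End Ptime.

(** Unlike in primitive recursion, the number of rounds need not be computed beforehand; the bound
    on [f] limits the time. It serves to locate the first nonzero digit of the input. *)
Lemma ptime_search (c : ctx) (P : c -> nat -> bool) (f : c -> nat) :
  ptime (fun g : ext c => P g.1 g.2) -> (forall g, P g (f g)) ->
  (forall g i, P g i -> f g <= i) -> pbounded f -> ptime f.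
Proof.
move=> pP Pf fmin bf.
have [p [T [_ bT h]]] : ptime (fun g : ext c => ~~ P g.1 g.2) by exact: ptime_neg.
have [K bK] := bT.
pose TB g := ((bd g).+2 + f g) ^ K.
(* Register [d.+1] holds the candidate and [d.+2] the negated test, which is the loop condition. *)
exists (fun locs d => Seq (Const d.+1 0) (Seq (p (d.+1 :: locs) d.+2)
  (Seq (While d.+2 (Seq (Succ d.+1) (p (d.+1 :: locs) d.+2))) (Copy d d.+1)))).
exists (fun g => 1 + (TB g + (f g * (TB g + 2) + 1 + 1))).
have bTB : pbounded TB.
  apply: pboundedX; apply: pboundedD => //.
  by apply: (@pbounded_le _ _ (fun g => bd g + 2)) => [g|];
    [lia | apply: pboundedD; [exact: pbounded_bd | exact: pbounded_const]].
split=> //.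
- by repeat first [exact: pbounded_const | assumption | apply: pboundedD
    | apply: pboundedM].
move=> g locs d s hs.
have test i s1 : i <= f g -> same d s s1 -> reg s1 d.+1 = i ->
    yields (inp g) (p (d.+1 :: locs) d.+2) d.+2 s1 (TB g) (~~ P g i).
  move=> le sm rd.
  have [|t [s2 [ex tT rv sm2]]] := h (g, i) (d.+1 :: locs) d.+2 s1.
    by apply: holds_ext => //; apply: holds_same hs sm _; lia.
  exists t, s2; split=> //; apply: leq_trans tT _; apply: leq_trans (bK _) _.
  by rewrite /TB; case: (K) => // K'; rewrite leq_exp2r //= /ext_bd /=; lia.
have loop r : forall i s1, i + r = f g -> same d s s1 -> reg s1 d.+1 = i ->
    reg s1 d.+2 = ~~ P g i ->
    exists t s2, [/\ exec (inp g)
       (While d.+2 (Seq (Succ d.+1) (p (d.+1 :: locs) d.+2))) s1 t s2,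
      t <= r * (TB g + 2) + 1, reg s2 d.+1 = f g & same d s s2].
  elim: r => [|r IH] i s1 ir sm rd rd1.
    exists 1, s1; split=> //; last by rewrite rd -ir addn0.
    by apply: ExecWhileDone; rewrite rd1 -(addn0 i) ir Pf.
  pose s2 := set_reg s1 d.+1 (reg s1 d.+1).+1.
  have sm2 : same d s s2 by apply: same_trans sm _; apply: same_set_reg.
  have [||t [s3 [ex tT rv sm3]]] := test i.+1 s2 _ sm2; first by lia.
    by rewrite /s2 reg_set eqxx rd.
  have [|||u [s4 [ex4 uT rv4 sm4]]] := IH i.+1 s3 _ _ _ rv.
  - lia.
  - by apply: same_trans sm2 (same_le _ sm3); lia.
  - by rewrite sm3.1 // /s2 reg_set eqxx rd.
  exists ((1 + t) + u).+1, s4; split=> //; last by lia.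
  apply: ExecWhileStep ex4.
    rewrite rd1; have [/fmin|//] := boolP (P g i); lia.
  exact: ExecSeq (ExecSucc _ _ _) ex.
pose s1 := set_reg s d.+1 0.
have sm1 : same d s s1 by exact: same_set_reg.
have [||t [s2 [ex tT rv sm2]]] := test 0 s1 _ sm1 => //.
  by rewrite /s1 reg_set eqxx.
have [|||u [s3 [ex3 uT rv3 sm3]]] := loop (f g) 0 s2 _ _ _ rv => //.
- by apply: same_trans sm1 (same_le _ sm2); lia.
- by rewrite sm2.1 // /s1 reg_set eqxx.
exists (1 + (t + (u + 1))), (set_reg s3 d (reg s3 d.+1)); split.
- apply: ExecSeq (ExecConst _ _ _ _) _; apply: ExecSeq ex _.
  exact: ExecSeq ex3 (ExecCopy _ _ _ _).
- lia.
- by rewrite reg_set eqxx.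
- by apply: same_trans sm3 (same_set_reg _ _ _).
Qed.

(** * Arithmetic, bounded quantifiers and digits by primitive recursion *)

Lemma ptimeD (c : ctx) (F F' : c -> nat) :
  ptime F -> ptime F' -> ptime (fun g => F g + F' g).
Proof.
move=> pF pF'; have addE g i : iteri i (fun _ a => a.+1) (F g) = F g + i.
  by elim: i => [|i IH] /=; rewrite ?IH; lia.
apply: (@ptime_ext _ (fun g => iteri (F' g) (fun _ a => a.+1) (F g))) => [g|].
  exact: addE.
apply: (@ptime_rec _ _ _ (fun g => F g + F' g)) => //.
- by apply: ptimeS; exact: ptime_var.
- by apply: pboundedD; exact: ptime_bounded.
- by move=> g i le; rewrite addE leq_add2l.
Qed.

Lemma ptimeB (c : ctx) (F F' : c -> nat) :
  ptime F -> ptime F' -> ptime (fun g => F g - F' g).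
Proof.
move=> pF pF'; have subE g i : iteri i (fun _ a => a.-1) (F g) = F g - i.
  by elim: i => [|i IH] /=; rewrite ?IH; lia.
apply: (@ptime_ext _ (fun g => iteri (F' g) (fun _ a => a.-1) (F g))) => [g|].
  exact: subE.
apply: (@ptime_rec _ _ _ F) => //.
- by apply: ptimeP; exact: ptime_var.
- exact: ptime_bounded.
- by move=> g i le; rewrite subE leq_subr.
Qed.

Lemma ptime_leq (c : ctx) (F F' : c -> nat) :
  ptime F -> ptime F' -> ptime (fun g => F g <= F' g).
Proof.
move=> pF pF'; apply: (@ptime_ext _ (fun g => 1 - (F g - F' g))) => [g|].
  by case: leqP => h; lia.
by apply: ptimeB; [exact: ptime_const | exact: ptimeB].
Qed.

Lemma ptime_and (c : ctx) (P Q : c -> bool) :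
  ptime (fun g => P g) -> ptime (fun g => Q g) ->
  ptime (fun g => P g && Q g).
Proof.
move=> pP pQ; apply: (@ptime_ext _ (fun g => if P g then Q g : nat else 0)).
  by move=> g; case: (P g).
by apply: ptime_if => //; exact: ptime_const.
Qed.

Lemma ptime_or (c : ctx) (P Q : c -> bool) :
  ptime (fun g => P g) -> ptime (fun g => Q g) ->
  ptime (fun g => P g || Q g).
Proof.
move=> pP pQ; apply: (@ptime_ext _ (fun g => if P g then 1 else Q g)).
  by move=> g; case: (P g).
by apply: ptime_if => //; exact: ptime_const.
Qed.

Lemma ptime_eq (c : ctx) (F F' : c -> nat) :
  ptime F -> ptime F' -> ptime (fun g => F g == F' g).
Proof.
move=> pF pF'.
apply: (@ptime_ext _ (fun g => (F g <= F' g) && (F' g <= F g))) => [g|].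
  by rewrite eqn_leq.
by apply: ptime_and; exact: ptime_leq.
Qed.

Lemma ptime_has (c : ctx) (N : c -> nat) (P : c -> nat -> bool) :
  ptime N ->
  ptime (fun g : ext c => P g.1 g.2) ->
  ptime (fun g => has (P g) (iota 0 (N g))).
Proof.
move=> pN pP.
have hasE g i : iteri i (fun j a => if P g j then 1 else a) 0
    = has (P g) (iota 0 i).
  elim: i => // i IH; rewrite -[in RHS]addn1 iotaD has_cat /= IH orbF add0n.
  by case: ifP => _; rewrite ?orbT ?orbF.
apply: ptime_ext (fun g => hasE g (N g)) _.
apply: (@ptime_rec _ _ _ (fun=> 1)) => //.
- exact: ptime_const.
- apply: (@ptime_if (ext (ext c)) (fun g => P g.1.1 g.1.2) (fun=> 1)).
  + exact: ptime_weak pP.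
  + exact: ptime_const.
  + exact: ptime_var.
- exact: pbounded_const.
- by move=> g i _; rewrite hasE leq_b1.
Qed.

Lemma ptime_all (c : ctx) (N : c -> nat) (P : c -> nat -> bool) :
  ptime N ->
  ptime (fun g : ext c => P g.1 g.2) ->
  ptime (fun g => all (P g) (iota 0 (N g))).
Proof.
move=> pN pP.
apply: (@ptime_ext _ (fun g => ~~ has (fun i => ~~ P g i) (iota 0 (N g)))).
  move=> g; rewrite -all_predC; congr nat_of_bool.
  by apply: eq_all => i /=; rewrite negbK.
by apply: ptime_neg; apply: ptime_has => //; exact: ptime_neg.
Qed.

Lemma ptimeM (c : ctx) (F F' : c -> nat) :
  ptime F -> ptime F' -> ptime (fun g => F g * F' g).
Proof.
move=> pF pF'; have mulE g i : iteri i (fun _ a => a + F g) 0 = F g * i.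
  by elim: i => [|i IH] /=; rewrite ?IH; lia.
apply: ptime_ext (fun g => mulE g (F' g)) _.
apply: (@ptime_rec _ _ _ (fun g => F g * F' g)) => //.
- exact: ptime_const.
- by apply: ptimeD; [exact: ptime_var | exact: ptime_weak (ptime_weak pF)].
- by apply: pboundedM; exact: ptime_bounded.
- by move=> g i le; rewrite mulE leq_mul2l le orbT.
Qed.

(** As the base is positive, the intermediate powers are at most the last one, which is bounded by
    hypothesis. *)
Lemma ptimeX (c : ctx) (F F' : c -> nat) :
  ptime F -> ptime F' -> (forall g, 0 < F g) ->
  pbounded (fun g => F g ^ F' g) -> ptime (fun g => F g ^ F' g).
Proof.
move=> pF pF' F0 bX; have expE g i : iteri i (fun _ a => a * F g) 1 = F g ^ i.
  by elim: i => [|i IH] //=; rewrite IH expnSr.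
apply: ptime_ext (fun g => expE g (F' g)) _.
apply: (@ptime_rec _ _ _ (fun g => F g ^ F' g)) => //.
- exact: ptime_const.
- by apply: ptimeM; [exact: ptime_var | exact: ptime_weak (ptime_weak pF)].
- by move=> g i le; rewrite expE leq_pexp2l.
Qed.

Lemma ptime_div (c : ctx) (F F' : c -> nat) :
  ptime F -> ptime F' -> (forall g, 0 < F' g) ->
  ptime (fun g => F g %/ F' g).
Proof.
move=> pF pF' F0.
(* The accumulator keeps the largest multiplier tried so far that fits; [F g] rounds suffice, as the
   quotient is at most [F g]. *)
have divE g i : iteri i (fun j a => if j.+1 * F' g <= F g then j.+1 else a) 0
    = minn i (F g %/ F' g).
  elim: i => [|i IH] /=; rewrite ?min0n // IH -leq_divRL //.
  by set q := F g %/ F' g; case: ltnP => h; lia.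
apply: (@ptime_ext _ _ _ (fun g => etrans (divE g (F g)) _)) => [g|].
  by apply/minn_idPr; exact: leq_div.
apply: (@ptime_rec _ _ _ F) => //.
- exact: ptime_const.
- have pi : ptime (fun g : ext (ext c) => g.1.2.+1).
    by apply: ptimeS; apply: ptime_weak; exact: ptime_var.
  apply: (@ptime_if _ (fun g : ext (ext c) => g.1.2.+1 * F' g.1.1 <= F g.1.1)
    (fun g => g.1.2.+1) (fun g => g.2)) => //; last exact: ptime_var.
  apply: ptime_leq; last exact: ptime_weak (ptime_weak pF).
  by apply: ptimeM => //; exact: ptime_weak (ptime_weak pF').
- exact: ptime_bounded.
- by move=> g i le; rewrite divE; apply: leq_trans (geq_minl _ _) le.
Qed.

Lemma ptime_mod (c : ctx) (F F' : c -> nat) :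
  ptime F -> ptime F' -> (forall g, 0 < F' g) ->
  ptime (fun g => F g %% F' g).
Proof.
move=> pF pF' F0.
apply: (@ptime_ext _ (fun g => F g - F g %/ F' g * F' g)) => [g|].
  by rewrite {1}(divn_eq (F g) (F' g)) addKn.
by apply: ptimeB => //; apply: ptimeM => //; exact: ptime_div.
Qed.

(** Repeated division, instead of division by [n ^ a], keeps all intermediate values at most [y]. *)
Definition digit n y a := iteri a (fun _ z => z %/ n) y %% n.

Lemma ptime_digit (c : ctx) (N Y A : c -> nat) : ptime N -> ptime Y -> ptime A ->
  (forall g, 0 < N g) -> ptime (fun g => digit (N g) (Y g) (A g)).
Proof.
move=> pN pY pA N0; apply: ptime_mod => //.
apply: (@ptime_rec _ _ _ Y) => //.
- by apply: ptime_div => //; [exact: ptime_var | exact: ptime_weak (ptime_weak pN)].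
- exact: ptime_bounded.
- by move=> g; elim=> //= i IH le; apply: leq_trans (leq_div _ _) (IH (ltnW le)).
Qed.

(** * Exhaustive search *)

Definition bit w q := odd (iter q half w).

Lemma bitS w q : bit w q.+1 = bit w./2 q.
Proof. by rewrite /bit iterSr. Qed.

Lemma bitSS w q : bit w.+1 q.+1 = bit (odd w + w./2) q.
Proof. by rewrite bitS /= uphalf_half. Qed.

Lemma bit0 q : bit 0 q = false.
Proof. by elim: q => // q IH; rewrite bitS. Qed.

(* Register 1 points to the current digit, register 2 holds its value. *)
Definition carry :=
  While 2 (Seq (Const 3 0) (Seq (Store 1 3) (Seq (Succ 1) (Fetch 2 1)))).

(** The loop clears the trailing ones, of which there are at most [r], and stops at the first zero.
    Writing the final 1 there is left to the caller, hence [set_cell] in the conclusion. *)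
Lemma exec_carry i r : forall w s, w < 2 ^ r ->
  (forall q, cell s (reg s 1 + q) = bit w q) -> reg s 2 = odd w ->
  exists t s', [/\ exec i carry s t s', t <= 5 * r + 1, reg s 1 <= reg s' 1,
    (forall q, cell (set_cell s' (reg s' 1) 1) (reg s 1 + q) = bit w.+1 q)
    & forall a, a < reg s 1 -> cell s' a = cell s a].
Proof.
elim: r => [|r IH] w s wr cs r2.
  have w0 : w = 0 by lia.
  exists 1, s; split=> //; first by apply: ExecWhileDone; rewrite r2 w0.
  move=> q /=; rewrite cs w0; case: q => [|q]; first by rewrite addn0 eqxx.
  by rewrite bitSS !bit0 ifN_eq //; lia.
case ow: (odd w) r2 => r2; last first.
  exists 1, s; split=> //; first exact: ExecWhileDone.
  move=> q /=; rewrite cs; case: q => [|q].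
    by rewrite addn0 eqxx /bit /= ow.
  by rewrite bitSS bitS ow ifN_eq //; lia.
pose p := reg s 1.
pose s1 := set_reg s 3 0; pose s2 := set_cell s1 p 0.
pose s3 := set_reg s2 1 p.+1; pose s4 := set_reg s3 2 (cell s3 p.+1).
have ex4 : exec i (Seq (Const 3 0) (Seq (Store 1 3) (Seq (Succ 1) (Fetch 2 1))))
    s (1 + (1 + (1 + 1))) s4.
  apply: ExecSeq (ExecConst _ _ _ _) _.
  apply: ExecSeq (ExecStore _ _ _ _) _.
  apply: ExecSeq (ExecSucc _ _ _) _.
  exact: (ExecFetch i 2 1 s3).
have cs4 q : cell s4 (p.+1 + q) = bit w./2 q.
  rewrite /s4 /= ifN_eq; last by lia.
  by rewrite addSnnS cs bitS.
have [|||t [s' [ex tT le cs' lo]]] := IH w./2 s4; rewrite -/p.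
- by move: wr; rewrite expnS; lia.
- exact: cs4.
- by have := cs4 0; rewrite addn0.
exists (1 + (1 + (1 + 1)) + t).+1, s'; split.
- by apply: ExecWhileStep ex4 ex; rewrite r2.
- lia.
- exact: ltnW le.
- move: le cs' lo; rewrite (_ : reg s4 1 = p.+1) // => le cs' lo.
  case=> [|q].
    rewrite addn0 /= ifN_eq; last by lia.
    by rewrite lo // /s4 /= eqxx /bit /= ow.
  by rewrite bitSS ow -cs' -/p addSnnS.
- move=> a ap; rewrite lo; last by rewrite (_ : reg s4 1 = p.+1) // ltnW.
  by rewrite /s4 /= ifN_eq //; rewrite /p; lia.
Qed.

Section Search.
Variables (X : Type) (ix : X -> nat -> bool) (b : X -> nat).

Fact memctx_mem_le (g : X * (nat -> bool)) a : g.2 a <= (b g.1).+1.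
Proof. by case: (g.2 a). Qed.

Fact memctx_regs_le (g : X * (nat -> bool)) v : v \in [::] -> v <= (b g.1).+1.
Proof. by []. Qed.

(** The memory is an arbitrary bit sequence, so that the routines apply to every state of the
    counter; the size depends on the input only. *)
Definition memctx : ctx :=
  @Ctx (X * (nat -> bool)) (fun g => ix g.1) (fun=> [::]) (fun g => g.2)
    (fun g => (b g.1).+1) memctx_mem_le memctx_regs_le.

Variables (n B : X -> nat) (chk : X -> (nat -> bool) -> bool)
  (out : X -> (nat -> bool) -> nat -> bool).

(** The cells below [B x] stay clear for the output. *)
Definition counter x w a := (B x <= a) && bit w (a - B x).

(** The search stops at the least value that passes [chk], hence after at most [w0] increments. The
    last hypothesis says that [out] reads only cells from [B x] on, so writing the output below them
    does not disturb it. *)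
Lemma counter_search :
  ptime (fun g : memctx => n g.1) -> ptime (fun g : memctx => B g.1) ->
  ptime (fun g : memctx => chk g.1 g.2) ->
  ptime (fun g : ext memctx => out g.1.1 g.1.2 g.2) ->
  (forall x f f' q, (forall a, B x <= a -> f a = f' a) -> out x f q = out x f' q) ->
  exists p K, forall x w0, w0 < 2 ^ B x -> chk x (counter x w0) ->
    exists w t s, [/\ chk x (counter x w), exec (ix x) p state0 t s,
      t <= w0.+1 * (b x).+3 ^ K, reg s 0 = n x
      & forall q, q < B x -> cell s q = out x (counter x w) q].
Proof.
move=> [pn [Tn [bn bTn hn]]] [pB [TB [bB bTB hB]]] pc
  [po [To [_ bTo ho]]] outP.
have [pk [Tk [_ bTk hk]]] : ptime (fun g : memctx => ~~ chk g.1 g.2).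
  exact: ptime_neg.
have [Kn lTn] := bTn; have [KB lTB] := bTB; have [Kk lTk] := bTk.
have [Ko lTo] := pbounded_ext bTo.
pose incr := Seq (pB [::] 1) (Seq (Fetch 2 1)
  (Seq carry (Seq (Const 3 1) (Store 1 3)))).
pose search := Seq (pk [::] 0) (While 0 (Seq incr (pk [::] 0))).
pose wloop := While 0 (Seq (po [:: 1] 2) (Seq (Store 1 2) (Seq (Succ 1) (Pred 0)))).
pose write := Seq (pB [::] 0) (Seq (Const 1 0) wloop).
(* This is [(bd g).+2] in [memctx]. Below, [S] bounds a round of the search, [O] the writing of the
   output and [U] the fixed costs together with one round. *)
pose M x := (b x).+3.
pose S x := M x ^ KB + (1 + (5 * B x + 1 + (1 + 1))) + M x ^ Kk + 1.
pose O x := B x * ((M x + B x) ^ Ko + 4) + 1.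
pose U x := M x ^ Kk + S x + 1 + (M x ^ KB + (1 + O x)) + M x ^ Kn.
have bM K : pbounded (fun g : memctx => M g.1 ^ K) by exists K => g.
have bM1 : pbounded (fun g : memctx => M g.1) by exists 1 => g; rewrite expn1.
have [K lU] : pbounded (fun g : memctx => U g.1).
  by repeat first [exact: pbounded_const | exact: bM | assumption
    | apply: pboundedX | apply: pboundedD | apply: pboundedM].
exists (Seq (Seq search write) (pn [::] 0)), K => x w0 w0B chk0.
have hold (f : nat -> bool) d s : (forall a, cell s a = f a) ->
    holds ((x, f) : memctx) [::] d s by [].
have [w1 chk1 min1] :=
  find_ex_minn (ex_intro _ w0 chk0 : exists w, chk x (counter x w)).
have w1B : w1 < 2 ^ B x by apply: leq_ltn_trans (min1 _ chk0) w0B.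
have test w s : (forall a, cell s a = counter x w a) ->
    exists t s', [/\ exec (ix x) (pk [::] 0) s t s', t <= M x ^ Kk,
      reg s' 0 = ~~ chk x (counter x w) & forall a, cell s' a = counter x w a].
  move=> cs; have [t [s' [ex tT rv [_ sm]]]] := hk _ _ 0 _ (hold _ _ _ cs).
  exists t, s'; split=> // [|a]; first exact: leq_trans tT (lTk _).
  by rewrite sm.
have step w s : w < 2 ^ B x -> (forall a, cell s a = counter x w a) ->
    exists t s', [/\ exec (ix x) incr s t s',
      t <= M x ^ KB + (1 + (5 * B x + 1 + (1 + 1)))
      & forall a, cell s' a = counter x w.+1 a].
  move=> wB cs; have [t [s1 [ex tT rv [_ sm]]]] := hB _ _ 1 _ (hold _ _ _ cs).
  pose s2 := set_reg s1 2 (cell s1 (reg s1 1)).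
  have cs2 q : cell s2 (reg s2 1 + q) = bit w q.
    by rewrite /s2 /= rv sm cs /counter leq_addr addKn.
  have [|||u [s3 [ex3 uT le cs3 lo]]] :=
    exec_carry (ix x) (r := B x) (w := w) (s := s2).
  - exact: wB.
  - exact: cs2.
  - by have := cs2 0; rewrite addn0.
  pose s4 := set_reg s3 3 1.
  exists (t + (1 + (u + (1 + 1)))), (set_cell s4 (reg s4 1) (reg s4 3)); split.
  - apply: ExecSeq ex _; apply: ExecSeq (ExecFetch _ _ _ _) _.
    apply: ExecSeq ex3 _; apply: ExecSeq (ExecConst _ _ _ _) _.
    exact: ExecStore.
  - by have := leq_trans tT (lTB _); rewrite -/(M x); lia.
  move=> a; move: le cs3 lo; rewrite (_ : reg s2 1 = B x) // => le cs3 lo.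
  have [Ba|aB] := leqP (B x) a.
    by rewrite /counter Ba /= -cs3 subnKC.
  rewrite /= ifN_eq; last by lia.
  rewrite lo // /s2 /= sm cs /counter.
  by rewrite leqNgt aB.
have loop r : forall w s, w + r = w1 -> (forall a, cell s a = counter x w a) ->
    reg s 0 = ~~ chk x (counter x w) ->
    exists t s', [/\ exec (ix x) (While 0 (Seq incr (pk [::] 0))) s t s',
      t <= r * S x + 1 & forall a, cell s' a = counter x w1 a].
  elim: r => [|r IH] w s wr cs r0.
    exists 1, s; split=> //; last by move=> a; rewrite cs -wr addn0.
    by apply: ExecWhileDone; rewrite r0 -(addn0 w) wr chk1.
  have [|t [s1 [ex tT cs1]]] := step w s _ cs; first by lia.
  have [t2 [s2 [ex2 tT2 rv2 cs2]]] := test _ _ cs1.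
  have [|u [s3 [ex3 uT cs3]]] := IH _ _ _ cs2 rv2; first by lia.
  exists (t + t2 + u).+1, s3; split=> //.
    apply: ExecWhileStep (ExecSeq ex ex2) ex3.
    by rewrite r0; have [/min1|//] := boolP (chk x (counter x w)); lia.
  by rewrite /S in uT *; lia.
have cs0 a : cell state0 a = counter x 0 a by rewrite /counter bit0 andbF.
have [t1 [s1 [ex1 tT1 rv1 cs1]]] := test _ _ cs0.
have [//|t2 [s2 [ex2 tT2 cs2]]] := loop w1 0 s1 _ cs1 rv1.
have [t3 [s3 [ex3 tT3 rv3 [_ sm3]]]] := hB _ _ 0 _ (hold _ _ _ cs2).
(* The memory after [j] cells of the output have been written. *)
pose W j a := if a < j then out x (counter x w1) a else counter x w1 a.
have wr r : forall j s, j + r = B x -> (forall a, cell s a = W j a) ->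
    reg s 0 = r -> reg s 1 = j ->
    exists t s', [/\ exec (ix x) wloop s t s', t <= r * ((M x + B x) ^ Ko + 4) + 1
      & forall a, cell s' a = W (B x) a].
  elim: r => [|r IH] j s jr cs r0 r1.
    exists 1, s; split=> //; first exact: ExecWhileDone.
    by move=> a; rewrite cs -jr addn0.
  have hs : holds (((x, W j), j) : ext memctx) [:: 1] 2 s.
    by apply: holds_ext => //; exact: hold.
  have [t [s4 [ex4 tT rv4 [sr4 sm4]]]] := ho _ _ _ _ hs.
  pose s5 := set_cell s4 (reg s4 1) (reg s4 2).
  pose s6 := set_reg s5 1 (reg s5 1).+1.
  pose s7 := set_reg s6 0 (reg s6 0).-1.
  have ex7 : exec (ix x) (Seq (po [:: 1] 2) (Seq (Store 1 2) (Seq (Succ 1) (Pred 0))))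
      s (t + (1 + (1 + 1))) s7.
    apply: ExecSeq ex4 _; apply: ExecSeq (ExecStore _ _ _ _) _.
    exact: ExecSeq (ExecSucc _ _ _) (ExecPred _ _ _).
  have [||||u [s8 [ex8 uT cs8]]] := IH j.+1 s7.
  - lia.
  - move=> a; rewrite /= sr4 // r1 rv4 /= sm4 cs /W ltnS.
    have [->|ne] := eqVneq a j.
      by rewrite leqnn; congr nat_of_bool; apply: outP => a' le; rewrite ifN //; lia.
    by rewrite [a <= j]leq_eqVlt (negPf ne).
  - by rewrite /= sr4 // r0.
  - by rewrite /= sr4 // r1.
  exists (t + (1 + (1 + 1)) + u).+1, s8; split=> //.
    by apply: ExecWhileStep ex7 ex8; rewrite r0.
  have tM : t <= (M x + B x) ^ Ko.
    apply: leq_trans tT _; apply: leq_trans (lTo _ _) _; rewrite -/(M x).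
    by case: (Ko) => // Ko'; rewrite leq_exp2r // leq_add2l; lia.
  lia.
pose s4 := set_reg s3 1 0.
have [||||t5 [s5 [ex5 tT5 cs5]]] := wr (B x) 0 s4 => //.
  by move=> a; rewrite /= sm3 cs2.
have cs5' : forall a, cell s5 a = (W (B x)) a by [].
have [t6 [s6 [ex6 tT6 rv6 [_ sm6]]]] := hn _ _ 0 _ (hold _ _ _ cs5').
exists w1, (t1 + t2 + (t3 + (1 + t5)) + t6), s6; split=> //.
- apply: ExecSeq ex6; apply: ExecSeq (ExecSeq ex1 ex2) _.
  by apply: ExecSeq ex3 _; apply: ExecSeq (ExecConst _ _ _ _) ex5.
- have w10 := min1 _ chk0.
  apply: (@leq_trans (w0.+1 * U x)); last first.
    by rewrite leq_mul2l; apply/orP; right; exact: (lU (x, counter x w0)).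
  have l3 : t3 <= M x ^ KB by exact: leq_trans tT3 (lTB _).
  have l6 : t6 <= M x ^ Kn by exact: leq_trans tT6 (lTn _).
  have l2 : w1 * S x <= w0 * S x by rewrite leq_mul2r w10 orbT.
  by rewrite -/(O x) in tT5; rewrite /U mulSn; nia.
- by move=> q qB; rewrite sm6 cs5 /W qB.
Qed.

End Search.

Local Open Scope ring_scope.

(** * Fractional Hadwiger numbers *)

Lemma connect_map (T U : finType) (e : rel T) (e' : rel U) (f : T -> U) x y :
  (forall u v, e u v -> connect e' (f u) (f v)) ->
  connect e x y -> connect e' (f x) (f y).
Proof.
move=> ee' /connectP[p pth ->]; elim: p x pth => //= z p IH x /andP[xz /IH].
exact: connect_trans (ee' _ _ xz).
Qed.

Lemma is_subgraph_induced (T : finType) (G : sgraph T) S :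
  is_subgraph G (induced G S).
Proof.
apply/forall_inP => p; rewrite inE => /and3P[Gp p1 p2].
by rewrite Gp p1 p2 inE /= edge_sym Gp p1 p2.
Qed.

(** Each projected branch set gets weight [1 / t]. The load of a vertex [v] is at most 1, because
    the branch sets over [v] use distinct ones of its [t] copies. *)
Lemma hadwiger_le_fhadwiger (R : realType) (T : finType) (G : sgraph T) (t : nat)
    (H : sgraph (T * 'I_t)%type) :
  (0 < t)%N -> (forall p q, H p q -> (p.1 == q.1) || G p.1 q.1) ->
  (hadwiger H)%:R <= fhadwiger R G * t%:R.
Proof.
move=> t0 HG.
have t0R : 0 < t%:R :> R by rewrite ltr0n.
have hs := has_sup_fhadwiger_values R G.
have le_val v : fhadwiger_values G v -> v <= fhadwiger R G.
  by move=> Hv; apply: ub_le_sup => //; case: hs.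
suff minor_le r : minor (complete_graph 'I_r) H -> r%:R <= fhadwiger R G * t%:R.
  rewrite /hadwiger; elim/big_ind: _ => [|x y|i /minor_le //].
    apply: mulr_ge0 => //; apply: le_val; exists finset.set0, (fun=> 0).
    split; last by rewrite big_set0.
      by apply/andP; split; apply/forall_inP => B; rewrite inE.
    by split=> // v; rewrite big1.
  by rewrite maxnE; case: (leqP x y) => xy; rewrite -maxnE;
    [rewrite (maxn_idPr xy) | rewrite (maxn_idPl (ltnW xy))].
case/existsP=> phi /and3P[/forallP cn /forallP dj /forallP jn].
pose B i := induced G (fst @: phi i).
pose BB := [set B i | i : 'I_r].
(* Several branch sets may have the same projection, so its weight counts them with multiplicity. *)
pose w C : R := (\sum_(i | B i == C) 1) / t%:R.
have sumw (Q : pred (subgraph T)) :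
    \sum_(C in BB | Q C) w C = (\sum_(i | Q (B i)) 1) / t%:R.
  rewrite -mulr_suml (partition_big B (fun C => (C \in BB) && Q C)) /=; last first.
    by move=> i Qi; rewrite Qi andbT imset_f.
  congr (_ / _); apply: eq_bigr => C /andP[_ QC]; apply: eq_bigl => i.
  by case: eqP => [->|]; rewrite ?QC ?andbF.
rewrite -ler_pdivrMr //; apply: le_val; exists BB, w; split.
- apply/andP; split; apply/forall_inP => _ /imsetP[i _ ->].
    rewrite is_subgraph_induced /=; have /andP[/set0Pn[p pi] /forall_inP ci] := cn i.
    apply/andP; split; first by apply/set0Pn; exists p.1; exact: imset_f.
    apply/forall_inP => _ /imsetP[x xi ->]; apply/forall_inP => _ /imsetP[y yi ->].
    have /forall_inP/(_ y yi) := ci x xi; apply: connect_map => u v.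
    rewrite !inE /= => /and3P[/HG /predU1P[->|Guv] ui vi] //.
    by apply: connect1; rewrite inE /= Guv !imset_f.
  apply/forall_inP => _ /imsetP[j _ ->].
  have [<-|nij] := eqVneq i j.
    have /andP[/set0Pn[p pi] _] := cn i.
    by apply/orP; left; apply/pred0Pn; exists p.1; rewrite /= imset_f.
  have /implyP/(_ nij) := forallP (jn i) j.
  case/exists_inP=> p pi /exists_inP[q qj /HG /predU1P[epq|Gpq]]; apply/orP.
    by left; apply/pred0Pn; exists p.1; rewrite /= imset_f // epq imset_f.
  right; apply/exists_inP; exists p.1; first exact: imset_f.
  by apply/exists_inP; exists q.1; first exact: imset_f.
- split=> [C _|v].
    by apply: divr_ge0 => //; apply: sumr_ge0.
  rewrite (sumw (fun C => v \in C.1)) ler_pdivrMr // mul1r sumr_const ler_nat.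
  have ex i : v \in fst @: phi i -> exists h, (v, h) \in phi i.
    by case/imsetP=> -[u h] pi ->; exists h.
  (* A copy of [v] in the branch set; [Ordinal t0] is only a default. Disjointness makes [h]
     injective on the branch sets over [v]. *)
  pose h (i : 'I_r) : 'I_t :=
    if [pick h | (v, h) \in phi i] is Some h then h else Ordinal t0.
  have hP i : v \in fst @: phi i -> (v, h i) \in phi i.
    by move=> /ex[h0 h0i]; rewrite /h; case: pickP => // /(_ h0); rewrite h0i.
  rewrite -[leqRHS]card_ord; apply: (@leq_trans #|h @: [pred i | v \in fst @: phi i]|).
    rewrite card_in_imset // => i j /hP hi /hP hj eh.
    apply/eqP/negPn/negP => nij.
    have /implyP/(_ nij) /pred0P/(_ (v, h i)) := forallP (dj i) j.
    by rewrite /= hi eh hj.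
  exact: max_card.
- have := sumw predT; rewrite sumr_const card_ord => <-.
  by apply: eq_bigl => C; rewrite andbT.
Qed.

(** * Greedy choice of disjoint small sets *)

Section Greedy.
Variables (R : realType) (T : finType) (w : subgraph T -> R) (s : nat).

(** The sets are arbitrary, not only connected ones, so that for a fixed family the condition
    concerns only the edges between its sets; these edge sets are disjoint for different pairs. *)
Definition blocking (k : nat) (G : sgraph T) :=
  forall f : nat -> {set T},
    (forall i, (i < k)%N -> (0 < #|f i| <= s)%N) ->
    (forall i j, (i < j < k)%N -> [disjoint f i & f j]) ->
    exists i j, (i < j < k)%N /\ ~~ joined G (f i) (f j).

Lemma greedy_disjoint (k : nat) (F : {set subgraph T}) :
  (0 < s)%N -> (forall C, C \in F -> (0 < #|C.1| <= s)%N) ->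
  (forall C, C \in F -> 0 <= w C) ->
  (forall v, \sum_(C in F | v \in C.1) w C <= 1) ->
  (k * s)%:R <= \sum_(C in F) w C ->
  exists f : nat -> subgraph T, (forall i, (i < k)%N -> f i \in F) /\
    (forall i j, (i < j < k)%N -> [disjoint (f i).1 & (f j).1]).
Proof.
move=> s0; elim: k F => [|k IH] F sF w0 w1 leF.
  by exists (fun=> (finset.set0, finset.set0)); split=> // i j; rewrite andbF.
have /set0Pn[C CF] : F != finset.set0.
  by apply: contraTneq leF => ->; rewrite big_set0 -ltNge ltr0n muln_gt0.
pose F' := [set C' in F | [disjoint C.1 & C'.1]].
have F'F C' : C' \in F' -> C' \in F by rewrite inE => /andP[].
have /(_ F')[||| |f [fF' fd]] := IH.
- by move=> C' /F'F /sF.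
- by move=> C' /F'F /w0.
- move=> v; apply: le_trans (w1 v).
  rewrite [leRHS](bigID (fun C' => C' \in F')) /=.
  rewrite (eq_bigl (fun C' => (C' \in F) && (v \in C'.1) && (C' \in F'))); last first.
    by move=> C'; case F'C: (C' \in F'); rewrite ?andbF ?andbT // (F'F _ F'C).
  by rewrite lerDl; apply: sumr_ge0 => C' /andP[/andP[/w0]].
- have : \sum_(C' in F) w C' <= \sum_(C' in F') w C' + s%:R.
    rewrite (bigID (fun C' => C' \in F')) /=.
    rewrite (eq_bigl (fun C' => C' \in F')); last first.
      by move=> C'; case F'C: (C' \in F'); rewrite ?andbF ?andbT // (F'F _ F'C).
    rewrite lerD2l.
    (* A discarded set contains a vertex of [C], so the discarded weight is at most the sum of the
       loads of these vertices. *)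
    apply: (@le_trans _ _ (\sum_(v in C.1) \sum_(C' in F | v \in C'.1) w C')).
      under [leRHS]eq_bigr do rewrite big_mkcondr.
      rewrite exchange_big /= big_mkcondr /=; apply: ler_sum => C' C'F.
      rewrite inE C'F /=; case: ifPn => [/pred0Pn[v /andP[/= vC vC']]|_].
        rewrite (bigD1 v) //= vC' lerDl; apply: sumr_ge0 => u _.
        by case: ifP => // _; exact: w0.
      by apply: sumr_ge0 => u _; case: ifP => // _; exact: w0.
    apply: le_trans (ler_sum _ (fun v _ => w1 v)) _.
    by rewrite sumr_const ler_nat; have /andP[] := sF _ CF.
  move=> le1; have := le_trans leF le1.
  by rewrite mulSn natrD addrC lerD2r.
exists (fun i => if i is i'.+1 then f i' else C); split=> [[|i] // /fF' /F'F //|].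
case=> [|i] [|j] // ij; last exact: fd.
by have := fF' j ij; rewrite inE => /andP[].
Qed.

(** Double counting: a set with more than [s] vertices contributes its weight at least [s + 1] times
    to the total load, which is at most [#|T|]. *)
Lemma fractional_weighting_small (BB : {set subgraph T}) :
  fractional_weighting BB w ->
  \sum_(C in BB | (s < #|C.1|)%N) w C <= #|T|%:R / s.+1%:R.
Proof.
move=> [w0 w1]; rewrite ler_pdivlMr ?ltr0n // mulr_suml.
have -> : #|T|%:R = \sum_(v : T) (1 : R) by rewrite sumr_const.
apply: le_trans (ler_sum _ (fun v _ => w1 v)).
under [leRHS]eq_bigr do rewrite big_mkcondr.
rewrite exchange_big /= big_mkcondr; apply: ler_sum => C CB.
rewrite -big_mkcond sumr_const -[leRHS]mulr_natr.
case: ifP => [sC|_]; last by rewrite mulr_ge0 ?w0.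
by rewrite ler_wpM2l ?w0 // ler_nat.
Qed.

End Greedy.

(** The second hypothesis concerns the weight left to the small sets once the large ones have taken
    at most [#|T| / (s + 1)]. *)
Lemma blocking_fhadwiger_le (R : realType) (T : finType) (G : sgraph T) (s k : nat)
    (e : R) :
  (0 < s)%N -> (k * s)%:R <= #|T|%:R * (e - s.+1%:R^-1) ->
  blocking s k G -> fhadwiger R G <= e * #|T|%:R.
Proof.
move=> s0 ks blk; apply: ge_sup; first by case: (has_sup_fhadwiger_values R G).
move=> _ [BB [w [/andP[/forall_inP br /forall_inP br2] fw ->]]].
rewrite leNgt; apply/negP => lt.
have [w0 w1] := fw.
pose F := [set C in BB | (#|C.1| <= s)%N].
have FB C : C \in F -> C \in BB by rewrite inE => /andP[].
have /(_ k F)[|||||f [fF fd]] := @greedy_disjoint R T w s.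
- exact: s0.
- move=> C CF; have /br/andP[_ /andP[ne _]] := FB _ CF.
  by move: CF; rewrite inE card_gt0 ne => /andP[].
- by move=> C /FB /w0.
- move=> v; apply: le_trans (w1 v).
  rewrite [leRHS](bigID (fun C => C \in F)) /=.
  rewrite (eq_bigl (fun C => (C \in BB) && (v \in C.1) && (C \in F))); last first.
    by move=> C; case FC: (C \in F); rewrite ?andbF ?andbT // (FB _ FC).
  by rewrite lerDl; apply: sumr_ge0 => C /andP[/andP[/w0]].
- have := fractional_weighting_small s fw.
  move: lt; rewrite (bigID (fun C : subgraph T => (#|C.1| <= s)%N)) /=.
  rewrite (eq_bigl (fun C => C \in F)); last by move=> C; rewrite inE.
  rewrite [X in _ + X](eq_bigl (fun C => (C \in BB) && (s < #|C.1|)%N)); last first.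
    by move=> C; rewrite ltnNge.
  move: ks; rewrite mulrBr; set x := \sum_(C in F) _; set y := \sum_(C in _ | _) _.
  rewrite [e * _]mulrC; move: (#|T|%:R * e) (#|T|%:R / s.+1%:R) ((k * s)%:R : R).
  by move: x y => x y a b c; lra.
have [||i [j [ij]]] := blk (fun i => (f i).1).
- move=> i ik; have := fF i ik; rewrite inE => /andP[/br/andP[_ /andP[ne _]] ->].
  by rewrite card_gt0 ne.
- exact: fd.
have /andP[ilj jk] := ij.
have /forall_inP/(_ (f j) (FB _ (fF _ jk))) := br2 _ (FB _ (fF _ (ltn_trans ilj jk))).
by rewrite fd //= => ->.
Qed.

Local Open Scope nat_scope.

(** * Existence of the graph *)

Lemma card_setType (D : finType) : #|{set D}| = 2 ^ #|D|.
Proof.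
by rewrite -[LHS]cardsT -finset.powersetT card_powerset cardsT.
Qed.

(* Independence: whether [w] hits the later sets depends only on [w :\: S i]. *)
Lemma card_hitting (D : finType) (I : eqType) (S : I -> {set D}) q (r : seq I) :
  uniq r -> (forall i, i \in r -> #|S i| <= q) ->
  (forall i j, i \in r -> j \in r -> i != j -> [disjoint S i & S j]) ->
  2 ^ (q * size r) * #|[set w : {set D} | all (fun i => ~~ [disjoint w & S i]) r]|
    <= (2 ^ q - 1) ^ size r * 2 ^ #|D|.
Proof.
elim: r => [|i r IH] /=.
  by rewrite muln0 !mul1n => _ _ _; rewrite -card_setType max_card.
move=> /andP[ir ur] Sq Sd.
have inr j : j \in r -> j \in i :: r by rewrite inE orbC => ->.
have {IH} := IH ur (fun j jr => Sq j (inr j jr))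
  (fun j l jr lr => Sd j l (inr j jr) (inr l lr)).
set A := [set w | all _ r]; pose M := [set w in A | [disjoint w & S i]].
have MA : M \subset A by apply/fintype.subsetP => w; rewrite inE => /andP[].
have -> : [set w : {set D} | ~~ [disjoint w & S i] &&
    all (fun j => ~~ [disjoint w & S j]) r] = A :\: M.
  by apply/setP => w; rewrite !inE; case: all; rewrite ?andbF ?andbT.
have leA : #|A| <= 2 ^ q * #|M|.
  pose f (w : {set D}) := (w :\: S i, w :&: S i).
  have fi : injective f.
    by move=> w w' [e1 e2]; rewrite -(finset.setID w (S i)) e1 e2 finset.setID.
  rewrite -(card_imset A fi).
  apply: (@leq_trans #|finset.setX M (powerset (S i))|).
    apply: subset_leq_card; apply/fintype.subsetP => _ /imsetP[w wA ->].
    rewrite !inE /= subsetIr andbT; apply/andP; split; last first.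
      by apply/pred0P => d /=; rewrite !inE; case: (d \in S i); rewrite ?andbF.
    move: wA; rewrite inE => /allP wA; apply/allP => j jr.
    have /pred0Pn[d /andP[/= dw dj]] := wA j jr.
    apply/pred0Pn; exists d; rewrite /= dj inE dw !andbT; apply/negP => di.
    have ij : i != j by apply: contraNneq ir => ->.
    have /pred0P/(_ d) := Sd i j (mem_head _ _) (inr j jr) ij.
    by rewrite /= di dj.
  rewrite cardsX card_powerset mulnC leq_mul2r leq_pexp2l ?orbT //.
  exact: Sq (mem_head _ _).
rewrite cardsDS // mulnS expnD expnS => IH.
have q0 : 0 < 2 ^ q by rewrite expn_gt0.
apply: (@leq_trans ((2 ^ q - 1) * (2 ^ (q * size r) * #|A|))); last first.
  by rewrite -mulnA leq_mul2l IH orbT.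
rewrite [2 ^ q * _]mulnC -mulnA [leqRHS]mulnCA leq_mul2l; apply/orP; right.
by rewrite mulnBr mulnBl mul1n; apply: leq_sub2l.
Qed.

(** The colexicographic numbering of unordered pairs, which spends a single bit on each possible
    edge. *)
Definition pair_index u v := 'C(maxn u v, 2) + minn u v.

Lemma pair_indexC u v : pair_index u v = pair_index v u.
Proof. by rewrite /pair_index maxnC minnC. Qed.

Lemma ltn_pair_index n u v : u < n -> v < n -> u != v -> pair_index u v < 'C(n, 2).
Proof.
wlog uv : u v / u < v => [th|un vn _].
  move=> un vn; rewrite neq_ltn => /orP[uv|vu]; first by apply: th => //; lia.
  by rewrite pair_indexC; apply: th => //; lia.
rewrite /pair_index (maxn_idPr (ltnW uv)) (minn_idPl (ltnW uv)).
apply: leq_trans (leq_bin2l 2 vn); rewrite binS bin1; lia.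
Qed.

(** As ['C(z.+1, 2) = 'C(z, 2) + z], the ranges of numbers for different larger elements do not
    overlap. *)
Lemma pair_index_inj u v u' v' : u != v -> u' != v' ->
  pair_index u v = pair_index u' v' -> (u = u' /\ v = v') \/ (u = v' /\ v = u').
Proof.
have ord x y x' y' : x < y -> x' < y' -> 'C(y, 2) + x = 'C(y', 2) + x' ->
    x = x' /\ y = y'.
  move=> xy xy' e; suff ey : y = y' by move: e; rewrite ey; lia.
  have H z z' t t' : t < z -> z < z' -> 'C(z, 2) + t < 'C(z', 2) + t'.
    move=> tz zz'; apply: leq_trans (leq_addr _ _).
    by apply: leq_trans (leq_bin2l 2 zz'); rewrite binS bin1; lia.
  case: (ltngtP y y') => // lt; first by have := H _ _ _ x' xy lt; lia.
  by have := H _ _ _ x xy' lt; lia.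
rewrite /pair_index !neq_ltn => /orP[] uv /orP[] uv' e;
  have [] := ord (minn u v) (maxn u v) (minn u' v') (maxn u' v'); lia.
Qed.

(** A family of [k] sets is listed as the rows of an array; repetitions in a row allow for sets of
    fewer than [s] elements. *)
Definition rows_disjoint k s (g : nat -> nat) := forall i j a b,
  i < j < k -> a < s -> b < s -> g (i * s + a) != g (j * s + b).

Definition pairs k : seq (nat * nat) := [seq (i, j) | j <- iota 0 k, i <- iota 0 j].

Lemma mem_pairs k i j : ((i, j) \in pairs k) = (i < j < k).
Proof.
apply/allpairsPdep/idP => [[j' [i']]|/andP[ij jk]].
  by rewrite !mem_iota => -[h1 h2 [-> ->]]; lia.
by exists j, i; rewrite !mem_iota.
Qed.

Lemma size_pairs k : size (pairs k) = 'C(k, 2).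
Proof.
rewrite size_allpairs_dep -bin2_sum sumnE big_map /index_iota subn0.
by apply: eq_bigr => j _; rewrite size_iota.
Qed.

Lemma uniq_pairs k : uniq (pairs k).
Proof.
apply: allpairs_uniq_dep; [exact: iota_uniq | by move=> *; exact: iota_uniq |].
by move=> [j i] [j' i'] _ _ /= [-> ->].
Qed.

Lemma row_index_lt i a k s : i < k -> a < s -> i * s + a < k * s.
Proof.
move=> ik as_; apply: (@leq_trans (i.+1 * s)); first by lia.
by rewrite leq_mul2r ik orbT.
Qed.

(** For a fixed array with disjoint rows, the pairs of rows involve disjoint sets of at most [s * s]
    edges, and [card_hitting] bounds the colourings in which none of these sets has only colour [c].
    The hypothesis sums this over both colours and all [n ^ (k * s)] arrays. *)
Lemma exists_balanced n s k :
  2 * n ^ (k * s) * (2 ^ (s * s) - 1) ^ 'C(k, 2) < 2 ^ (s * s * 'C(k, 2)) ->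
  exists f : nat -> bool, forall g : nat -> nat,
    (forall a, a < k * s -> g a < n) -> rows_disjoint k s g ->
    forall c, exists i j, i < j < k /\ forall a b, a < s -> b < s ->
      f (pair_index (g (i * s + a)) (g (j * s + b))) = c.
Proof.
set L := k * s; set q := s * s; set r := 'C(k, 2) => num.
(* The successor makes the ordinal type nonempty, as [inord] requires. *)
pose P := 'C(n, 2); pose D := 'I_P.+1.
pose gn (g : {ffun 'I_L -> 'I_n}) a := if insub a is Some a' then g a' : nat else 0.
pose F g (p : nat * nat) (ab : 'I_s * 'I_s) : D :=
  inord (pair_index (gn g (p.1 * s + ab.1)) (gn g (p.2 * s + ab.2))).
pose bad c g := [set w : {set D} | `[< rows_disjoint k s (gn g) >] &&
  all (fun p => [exists ab, (F g p ab \in w) == c]) (pairs k)].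
have gn_lt g a : a < L -> gn g a < n.
  by move=> aL; rewrite /gn insubT /=.
have cardt g : 2 ^ (q * r) * #|bad true g| <= (2 ^ q - 1) ^ r * 2 ^ P.+1.
  have [rd|nrd] := pselect (rows_disjoint k s (gn g)); last first.
    rewrite (_ : bad true g = finset.set0) ?cards0 ?muln0 //.
    by apply/setP => w; rewrite !inE; case: asboolP.
  (* The possible edges between the two rows of the pair [p]. *)
  pose S p := F g p @: [set: 'I_s * 'I_s].
  have badE : bad true g =
      [set w : {set D} | all (fun p => ~~ [disjoint w & S p]) (pairs k)].
    apply/setP => w; rewrite !inE asboolT //=; apply: eq_all => p.
    apply/existsP/pred0Pn => [[ab /eqP Fw]|[d /andP[/= dw /imsetP[ab _ dE]]]].
      by exists (F g p ab); rewrite /= Fw imset_f.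
    by exists ab; rewrite -dE dw.
  have := @card_hitting D _ S q (pairs k) (uniq_pairs k).
  rewrite size_pairs (card_ord P.+1 : #|D| = _) badE; apply.
  - move=> p _; apply: leq_trans (leq_imset_card _ _) _.
    by rewrite cardsT card_prod card_ord.
  move=> [i j] [i' j']; rewrite !mem_pairs => ij ij' ne.
  apply/pred0P => d; apply/negP => /andP[/= /imsetP[[a b] _ ->] /imsetP[[a' b'] _ /=]].
  have [/andP[lij jk] /andP[lij' jk']] := (ij, ij').
  have lt u (x : 'I_s) : u < k -> gn g (u * s + x) < n.
    by move=> uk; apply: gn_lt; exact: row_index_lt.
  have ik := ltn_trans lij jk; have ik' := ltn_trans lij' jk'.
  have lti := ltn_pair_index.
  move=> /(congr1 val); rewrite /= !inordK ?ltnS; first last.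
  - by apply: ltnW; apply: lti; [exact: lt | exact: lt | exact: rd].
  - by apply: ltnW; apply: lti; [exact: lt | exact: lt | exact: rd].
  have row_eq u v (x y : 'I_s) : u < k -> v < k ->
      gn g (u * s + x) = gn g (v * s + y) -> u = v.
    move=> uk vk e; case: (ltngtP u v) => // uv.
      by have := rd u v x y; rewrite uv vk e eqxx => /(_ isT (ltn_ord _) (ltn_ord _)).
    by have := rd v u y x; rewrite uv uk e eqxx => /(_ isT (ltn_ord _) (ltn_ord _)).
  case/pair_index_inj; [exact: rd | exact: rd | |].
    move=> [/row_eq e1 /row_eq e2].
    by move: ne; rewrite (e1 ik ik' : i = i') (e2 jk jk' : j = j') eqxx.
  move=> [/row_eq e1 /row_eq e2].
  by have := e1 ik jk' : i = j'; have := e2 jk ik' : j = i'; lia.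
have cardb c g : 2 ^ (q * r) * #|bad c g| <= (2 ^ q - 1) ^ r * 2 ^ P.+1.
  case: c => //; suff -> : #|bad false g| = #|bad true g| by [].
  (* Complementation exchanges the two colours. *)
  have <- : [set ~: w | w in bad true g] = bad false g.
    apply/setP => w; rewrite -[w]finset.setCK.
    rewrite mem_imset; last exact: inv_inj (@finset.setCK _).
    rewrite !inE finset.setCK; congr (_ && _); apply: eq_all => p.
    by apply: eq_existsb => ab; rewrite inE; case: (_ \in _).
  by rewrite card_imset //; exact: inv_inj (@finset.setCK _).
have [w wP] : exists w, forall c g, w \notin bad c g.
  apply: contrapT => now.
  have sub : [set: {set D}] \subset
      \bigcup_(g : {ffun 'I_L -> 'I_n}) (bad true g :|: bad false g).
    apply/fintype.subsetP => w _; apply: contrapT => nw; apply: now; exists w => c g.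
    apply: contra_notN nw => wb; apply/bigcupP; exists g => //.
    by rewrite inE; case: c wb => ->; rewrite ?orbT.
  have := subset_leq_card sub; rewrite cardsT card_setType card_ord => le1.
  have le2 : #|\bigcup_(g : {ffun 'I_L -> 'I_n}) (bad true g :|: bad false g)|
      <= \sum_(g : {ffun 'I_L -> 'I_n}) (#|bad true g| + #|bad false g|).
    elim/big_rec2: _ => [|g x y _ le]; first by rewrite cards0.
    apply: leq_trans (leq_card_setU _ _) _; apply: leq_add => //.
    exact: leq_card_setU.
  have : 2 ^ (q * r) * 2 ^ P.+1
      <= n ^ L * (2 * ((2 ^ q - 1) ^ r * 2 ^ P.+1)).
    apply: (@leq_trans (2 ^ (q * r) *
      \sum_(g : {ffun 'I_L -> 'I_n}) (#|bad true g| + #|bad false g|))).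
      by rewrite leq_mul2l (leq_trans le1 le2) orbT.
    have cf : #|{ffun 'I_L -> 'I_n}| = n ^ L by rewrite card_ffun !card_ord.
    rewrite big_distrr /= -cf -sum_nat_const; apply: leq_sum => g _.
    by rewrite mulnDr mul2n -addnn leq_add.
  rewrite [_ * (_ * _)](_ : _ = 2 * n ^ L * (2 ^ q - 1) ^ r * 2 ^ P.+1); last by lia.
  by rewrite leq_pmul2r ?expn_gt0 // leqNgt num.
exists (fun p => inord p \in w) => g gn' rd c.
pose g' : {ffun 'I_L -> 'I_n} := [ffun a : 'I_L => Ordinal (gn' a (ltn_ord a))].
have g'E a : a < L -> gn g' a = g a by move=> aL; rewrite /gn insubT ffunE.
have rd' : rows_disjoint k s (gn g').
  move=> i j a b ij al bl; have /andP[lij jk] := ij; have ik := ltn_trans lij jk.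
  by rewrite !g'E; [exact: rd | exact: row_index_lt | exact: row_index_lt].
(* Outside [bad (~~ c)], some pair of rows has no entry of colour [~~ c], hence only entries of
   colour [c]. *)
have := wP (~~ c) g'; rewrite inE asboolT //= => /allPn[[i j]].
rewrite mem_pairs => ij /existsPn ne; exists i, j; split=> // a b al bl.
have := ne (Ordinal al, Ordinal bl); rewrite /F /=.
have /andP[lij jk] := ij; have ik := ltn_trans lij jk.
rewrite !g'E; [|exact: row_index_lt | exact: row_index_lt].
by case: (_ \in _); case: c {ne}.
Qed.

(* The exponents are chosen so that [nverts s = 2 ^ (3 s) * blocks s] with
   [s ^ 2 (s + 1) <= 2 ^ (3 s)], as the greedy choice requires, and so that the
   remaining factor [2 ^ (3 s + 5)] of [blocks s] beats the number of families. *)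
Definition vexp s := (s + 1) * (s + 5).
Definition nverts s := 2 ^ vexp s.
Definition blocks s := 2 ^ (s * s + (3 * s + 5)).

(** Bernoulli's inequality for [(1 + 1 / x) ^ m], cleared of denominators. *)
Lemma leq_mul_expS x m : x ^ m * (x + m) <= x * x.+1 ^ m.
Proof.
elim: m => [|m IH]; first by rewrite !expn0 addn0 mul1n muln1.
rewrite !expnS; apply: (@leq_trans (x ^ m * (x + m) * x.+1)).
  by rewrite -!mulnA [leqLHS]mulnCA leq_mul2l; apply/orP; right; nia.
by rewrite [leqRHS]mulnCA [leqLHS]mulnC leq_mul2l IH orbT.
Qed.

(** This is [(1 - 1 / Q) ^ Q <= 1 / 2], by Bernoulli's inequality with base [Q - 1] and exponent
    [Q]. *)
Lemma double_expn_pred Q : 0 < Q -> 2 * (Q - 1) ^ Q <= Q ^ Q.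
Proof.
case: Q => // x _; rewrite subSS subn0.
case: x => [|x]; first by rewrite exp0n.
have := leq_mul_expS x.+1 x.+2.
move=> H; rewrite -(leq_pmul2l (ltn0Sn x)); apply: leq_trans H.
by move: (x.+1 ^ x.+2) => P; nia.
Qed.

Lemma cube_leq_exp s : (s + 1) ^ 3 <= 2 ^ (3 * s).
Proof. by rewrite mulnC expnM leq_exp2r // addn1 ltn_expl. Qed.

(** Since ['C(k, 2) = 2 ^ q * E], the failure probability [(1 - 2 ^ - q) ^ 'C(k, 2)] is at most
    [2 ^ - E], and [E] exceeds the exponent of 2 in the number of families and colours. *)
Lemma union_bound s : 0 < s ->
  2 * nverts s ^ (blocks s * s) * (2 ^ (s * s) - 1) ^ 'C(blocks s, 2)
    < 2 ^ (s * s * 'C(blocks s, 2)).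
Proof.
move=> s0; set q := s * s; set k := blocks s.
have q0 : 0 < q by rewrite muln_gt0 s0.
pose t := 3 * s + 4; pose E := (k - 1) * 2 ^ t.
have kE : k = 2 * (2 ^ q * 2 ^ t).
  by rewrite /k /blocks -expnD -expnS; congr (2 ^ _); rewrite /t /q; lia.
have k2 : 2 <= k by rewrite kE -[leqLHS]muln1 leq_mul2l muln_gt0 !expn_gt0.
have -> : 'C(k, 2) = 2 ^ q * E.
  rewrite bin2 (_ : k * k.-1 = (2 ^ q * E).*2) ?doubleK // -mul2n /E -subn1 {1}kE.
  by move: (2 ^ q) (2 ^ t) (k - 1) => a b d; nia.
have Qpos : 0 < 2 ^ q - 1 by rewrite subn_gt0 -{1}(expn0 2) ltn_exp2l.
have ltE : vexp s * (k * s) + 1 < E.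
  have c3 := cube_leq_exp s.
  (* The factor 2 compensates for [k - 1] in place of [k] in [E]. *)
  have lt : 2 * (vexp s * s + 1) <= 2 ^ t.
    rewrite /t expnD; apply: (@leq_trans ((s + 1) ^ 3 * 2 ^ 4)).
      by rewrite /vexp !expnS expn0; nia.
    by rewrite leq_mul2r c3 orbT.
  rewrite /E; apply: (@leq_trans ((k - 1) * (2 * (vexp s * s + 1)))); last first.
    by rewrite leq_mul2l lt orbT.
  by move: (vexp s) => m; nia.
rewrite /nverts -expnM -expnS.
apply: (@leq_trans (2 ^ E * (2 ^ q - 1) ^ (2 ^ q * E))).
  rewrite ltn_pmul2r ?expn_gt0 ?Qpos // ltn_exp2l //; lia.
rewrite expnM -expnMn mulnA [2 ^ (q * _ * _)]expnM [2 ^ (q * _)]expnM.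
have E0 : 0 < E by apply: leq_ltn_trans ltE.
by rewrite leq_exp2r // double_expn_pred // expn_gt0.
Qed.

(** * Numbers as colourings and arrays, and the exhaustive test *)

Lemma exists_bits (f : nat -> bool) N :
  exists2 w, w < 2 ^ N & forall q, q < N -> bit w q = f q.
Proof.
elim: N f => [|N IH] f; first by exists 0.
have [w wN wf] := IH (fun q => f q.+1).
exists (f 0 + w.*2); first by rewrite expnS; case: (f 0); lia.
case=> [|q] qN; first by rewrite /bit /= oddD odd_double addbF; case: (f 0).
by rewrite bitS half_bit_double wf.
Qed.

Lemma exists_digits n (g : nat -> nat) L : (forall a, a < L -> g a < n) ->
  exists2 y, y < n ^ L & forall a, a < L -> digit n y a = g a.
Proof.
elim: L g => [|L IH] g gn; first by exists 0.
have [|y yL yg] := IH (fun a => g a.+1); first by move=> a aL; exact: gn.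
have n0 : 0 < n by apply: leq_ltn_trans (gn 0 _).
exists (y * n + g 0).
  rewrite expnSr; apply: (@leq_trans (y.+1 * n)); last by rewrite leq_mul2r yL orbT.
  by rewrite mulSn addnC ltn_add2r gn.
have itS a : iteri a.+1 (fun _ z => z %/ n) (y * n + g 0)
    = iteri a (fun _ z => z %/ n) y.
  elim: a => [|a /= ->] //=; by rewrite divnMDl // divn_small ?addn0 ?gn.
case=> [|a] aL; first by rewrite /digit /= modnMDl modn_small // gn.
by rewrite /digit itS -yg.
Qed.

(* The digits of [y] in base [n] are read as a [k] by [s] array of vertices, in
   row order; each row lists a set of vertices, possibly with repetitions. *)
Definition rows_meet n s k y :=
  has (fun j => has (fun i => has (fun a => has (fun b =>
    digit n y (i * s + a) == digit n y (j * s + b)) (iota 0 s)) (iota 0 s))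
    (iota 0 j)) (iota 0 k).

Definition rows_monochromatic n s k (f : nat -> bool) y (c : bool) :=
  has (fun j => has (fun i => all (fun a => all (fun b =>
    f (pair_index (digit n y (i * s + a)) (digit n y (j * s + b))) == c :> nat)
    (iota 0 s)) (iota 0 s)) (iota 0 j)) (iota 0 k).

Definition check n s k f := all (fun y => rows_meet n s k y ||
  (rows_monochromatic n s k f y true && rows_monochromatic n s k f y false))
  (iota 0 (n ^ (k * s))).

Lemma has_iotaP n (P : pred nat) :
  reflect (exists2 i, i < n & P i) (has P (iota 0 n)).
Proof.
by apply: (iffP hasP) => -[i]; rewrite ?mem_iota => ? ?; exists i;
  rewrite ?mem_iota.
Qed.

Lemma all_iotaP n (P : pred nat) :
  reflect (forall i, i < n -> P i) (all P (iota 0 n)).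
Proof.
apply: (iffP allP) => h i; last by rewrite mem_iota; exact: h.
by move=> lt; apply: h; rewrite mem_iota.
Qed.

Lemma rows_meetP n s k y :
  reflect (~ rows_disjoint k s (digit n y)) (rows_meet n s k y).
Proof.
apply: (iffP idP) => [/has_iotaP[j jk /has_iotaP[i ij]]|nrd].
  case/has_iotaP=> a al /has_iotaP[b bl /eqP e] rd.
  by have := rd i j a b; rewrite ij jk e eqxx => /(_ isT al bl).
apply/negPn/negP => nm; apply: nrd => i j a b /andP[ij jk] al bl.
apply: contraNneq nm => e; apply/has_iotaP; exists j => //.
apply/has_iotaP; exists i => //; apply/has_iotaP; exists a => //.
by apply/has_iotaP; exists b => //; rewrite e.
Qed.

Lemma rows_monochromaticP n s k f y c :
  reflect (exists i j, i < j < k /\ forall a b, a < s -> b < s ->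
      f (pair_index (digit n y (i * s + a)) (digit n y (j * s + b))) = c)
    (rows_monochromatic n s k f y c).
Proof.
apply: (iffP (has_iotaP _ _)) => [[j jk /has_iotaP[i ij h]]|[i [j [/andP[ij jk] h]]]].
  exists i, j; rewrite ij jk; split=> // a b al bl.
  have /all_iotaP/(_ b bl) := all_iotaP _ _ h a al.
  by case: (f _); case: (c).
exists j => //; apply/has_iotaP; exists i => //.
by apply/all_iotaP => a al; apply/all_iotaP => b bl; rewrite h.
Qed.

(** Every array with entries below [n] is the digit expansion of some tested number, so the finite
    test decides the property provided by [exists_balanced]. *)
Lemma checkP n s k f : 0 < n ->
  reflect (forall g : nat -> nat,
    (forall a, a < k * s -> g a < n) -> rows_disjoint k s g ->
    forall c, exists i j, i < j < k /\ forall a b, a < s -> b < s ->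
      f (pair_index (g (i * s + a)) (g (j * s + b))) = c) (check n s k f).
Proof.
move=> n0; apply: (iffP (all_iotaP _ _)) => [h g gn rd c|h y _].
  have [y yL yg] := exists_digits gn.
  have E i a : i < k -> a < s -> digit n y (i * s + a) = g (i * s + a).
    by move=> ik al; rewrite yg // row_index_lt.
  have : rows_monochromatic n s k f y c.
    have /orP[/rows_meetP[]|/andP[]] := h y yL; last by case: c.
    move=> i j a b /andP[ij jk] al bl.
    by rewrite !E // ?(ltn_trans ij) //; apply: rd => //; rewrite ij.
  case/rows_monochromaticP=> i [j [ij hij]]; exists i, j; split=> // a b al bl.
  have /andP[lij jk] := ij.
  by rewrite -!E ?hij // (ltn_trans lij).
case: rows_meetP => //= /contrapT rd.
have gn a : a < k * s -> digit n y a < n by rewrite ltn_mod.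
by apply/andP; split; apply/rows_monochromaticP; exact: h.
Qed.

Definition bit_edge n (f : nat -> bool) : rel 'I_n :=
  fun u v => (u != v) && f (pair_index u v).

Fact bit_edge_sym n f : symmetric (@bit_edge n f).
Proof. by move=> u v; rewrite /bit_edge eq_sym pair_indexC. Qed.

Fact bit_edge_irr n f : irreflexive (@bit_edge n f).
Proof. by move=> u; rewrite /bit_edge eqxx. Qed.

Definition bit_graph n f := SGraph (@bit_edge_sym n f) (@bit_edge_irr n f).

(** With the sets listed as rows, colour [false] gives a pair that is not joined in the graph, and
    colour [true] one that is not joined in its complement. *)
Lemma check_blocking n s k f : 0 < n -> check n s k f ->
  blocking s k (bit_graph n f) /\ blocking s k (compl (bit_graph n f)).
Proof.
move=> n0 /(checkP _ _ _ n0) chk.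
have key (F : nat -> {set 'I_n}) : (forall i, i < k -> 0 < #|F i| <= s) ->
    (forall i j, i < j < k -> [disjoint F i & F j]) ->
    forall c, exists i j, i < j < k /\ forall u v, u \in F i -> v \in F j ->
      u != v /\ f (pair_index u v) = c.
  move=> Fs Fd c; pose x0 : 'I_n := Ordinal n0.
  (* A row with fewer than [s] elements is filled up with its first one. *)
  pose h i a := nth (head x0 (enum (F i))) (enum (F i)) a.
  have hF i a : i < k -> h i a \in F i.
    move=> /Fs /andP[Fi _]; rewrite -mem_enum /h.
    have [lt|ge] := ltnP a (size (enum (F i))); first exact: mem_nth.
    rewrite nth_default //; move: Fi; rewrite cardE.
    by case: (enum _) => //= z l _; rewrite mem_head.
  have Fh i v : i < k -> v \in F i -> exists2 a, a < s & h i a = v.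
    move=> /Fs /andP[_ Fi] vF; exists (index v (enum (F i))).
      by apply: leq_trans Fi; rewrite cardE index_mem mem_enum.
    by rewrite /h nth_index // mem_enum.
  pose g a : nat := h (a %/ s) (a %% s).
  have gE i a : a < s -> g (i * s + a) = h i a.
    move=> al; rewrite /g divnMDl ?(leq_ltn_trans _ al) // divn_small // addn0.
    by rewrite modnMDl modn_small.
  have dj i j u v : i < j < k -> u \in F i -> v \in F j -> u != v.
    by move=> ij ui vj; apply: contraTneq ui => ->; rewrite (disjointFl (Fd _ _ ij)).
  have [||i [j [ij hij]]] := chk g _ _ c.
  - by move=> a _; exact: ltn_ord.
  - move=> i j a b ij al bl; rewrite !gE //; have /andP[lij jk] := ij.
    by apply: (dj i j) => //; apply: hF => //; exact: ltn_trans jk.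
  exists i, j; split=> // u v ui vj; split; first exact: dj ij ui vj.
  have /andP[lij jk] := ij.
  have [a al ua] := Fh _ _ (ltn_trans lij jk) ui; have [b bl vb] := Fh _ _ jk vj.
  by rewrite -(hij a b) // !gE // ua vb.
split=> F Fs Fd.
  have [i [j [ij h]]] := key F Fs Fd false; exists i, j; split=> //.
  apply/negP => /exists_inP[u ui /exists_inP[v vj /andP[_]]].
  by have [_ ->] := h u v ui vj.
have [i [j [ij h]]] := key F Fs Fd true; exists i, j; split=> //.
apply/negP => /exists_inP[u ui /exists_inP[v vj /andP[_]]].
by have [uv fuv] := h u v ui vj; rewrite /= /bit_edge uv fuv.
Qed.

(** * The test runs in polynomial time *)

Ltac ptime_atom := first
  [ exact: ptime_const | exact: ptime_var | exact: (ptime_weak (@ptime_var _))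
  | exact: (ptime_weak (ptime_weak (@ptime_var _)))
  | exact: (ptime_weak (ptime_weak (ptime_weak (@ptime_var _))))
  | match goal with H : ptime _ |- _ => first
     [ exact: H | exact: (ptime_weak H) | exact: (ptime_weak (ptime_weak H))
     | exact: (ptime_weak (ptime_weak (ptime_weak H)))
     | exact: (ptime_weak (ptime_weak (ptime_weak (ptime_weak H)))) ] end ].

Lemma ptime_pair_index (c : ctx) (U V : c -> nat) : ptime U -> ptime V ->
  ptime (fun g => pair_index (U g) (V g)).
Proof.
have bin (F : c -> nat) : ptime F -> ptime (fun g => 'C(F g, 2)).
  move=> pF; apply: (@ptime_ext _ (fun g => F g * (F g).-1 %/ 2)) => [g|].
    by rewrite bin2 divn2.
  apply: ptime_div => //; last exact: ptime_const.
  by apply: ptimeM => //; exact: ptimeP.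
move=> pU pV.
apply: (@ptime_ext _ (fun g => if U g <= V g then 'C(V g, 2) + U g
                               else 'C(U g, 2) + V g)) => [g|].
  by rewrite /pair_index maxnE minnE; case: leqP => h; congr ('C(_, 2) + _); lia.
apply: ptime_if; first exact: ptime_leq.
  by apply: ptimeD => //; exact: bin.
by apply: ptimeD => //; exact: bin.
Qed.

Section PtimeCheck.
Variables (c : ctx) (N S K Y A : c -> nat) (f : c -> nat -> bool).
Hypotheses (pN : ptime N) (pS : ptime S) (pK : ptime K) (pY : ptime Y)
  (N_gt0 : forall g, 0 < N g).

Let ptime_entry (i a : ext (ext (ext (ext c))) -> nat) :
  ptime i -> ptime a ->
  ptime (fun g : ext (ext (ext (ext c))) =>
    digit (N g.1.1.1.1) (Y g.1.1.1.1) (i g * S g.1.1.1.1 + a g)).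
Proof.
move=> pi pa; apply: ptime_digit; try ptime_atom; last by move=> g; exact: N_gt0.
by apply: ptimeD => //; apply: ptimeM; ptime_atom.
Qed.

Lemma ptime_rows_meet : ptime (fun g => rows_meet (N g) (S g) (K g) (Y g)).
Proof.
apply: ptime_has; first ptime_atom.
apply: ptime_has; first ptime_atom.
apply: ptime_has; first ptime_atom.
apply: ptime_has; first ptime_atom.
by apply: ptime_eq; apply: ptime_entry; ptime_atom.
Qed.

Hypotheses (pA : ptime A) (memE : forall g q, cmem g (A g + q) = f g q).

(** The colouring is looked up in the memory, where it starts at cell [A g]. *)
Lemma ptime_rows_monochromatic b :
  ptime (fun g => rows_monochromatic (N g) (S g) (K g) (f g) (Y g) b).
Proof.
apply: ptime_has; first ptime_atom.
apply: ptime_has; first ptime_atom.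
apply: ptime_all; first ptime_atom.
apply: ptime_all; first ptime_atom.
apply: ptime_eq; last exact: ptime_const.
apply: (@ptime_ext _ (fun g : ext (ext (ext (ext c))) => cmem g (A g.1.1.1.1 +
  pair_index (digit (N g.1.1.1.1) (Y g.1.1.1.1) (g.1.1.2 * S g.1.1.1.1 + g.1.2))
    (digit (N g.1.1.1.1) (Y g.1.1.1.1) (g.1.1.1.2 * S g.1.1.1.1 + g.2))))) => [g|].
  exact: memE.
apply: ptime_mem; apply: ptimeD; first ptime_atom.
by apply: ptime_pair_index; apply: ptime_entry; ptime_atom.
Qed.

End PtimeCheck.

(** Polynomial in a size that must already account for the [n ^ (k * s)] arrays. *)
Lemma ptime_check (c : ctx) (N S K A : c -> nat) (f : c -> nat -> bool) :
  ptime N -> ptime S -> ptime K -> ptime A -> (forall g, 0 < N g) ->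
  pbounded (fun g => N g ^ (K g * S g)) ->
  (forall g q, cmem g (A g + q) = f g q) ->
  ptime (fun g => check (N g) (S g) (K g) (f g)).
Proof.
move=> pN pS pK pA N0 bX memE.
apply: ptime_all; first by apply: ptimeX => //; exact: ptimeM.
apply: ptime_or.
  by apply: (@ptime_rows_meet (ext c)) => //; ptime_atom.
by apply: ptime_and;
  apply: (@ptime_rows_monochromatic (ext c) _ _ _ _ (fun g => A g.1)
    (fun g => f g.1)) => [||||g||g q] //; try ptime_atom; exact: memE.
Qed.

Local Open Scope ring_scope.
Local Open Scope classical_set_scope.

(** * Computing the block size from the input *)

Section BlockSize.
Variable R : realType.
Implicit Type e : R.

(* Reading [2 j + 3] digits, where [j] is the position of the first nonzero one,
   determines [1 / e] up to an additive constant. *)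
Definition first_bit e : nat :=
  if pselect (exists j, 1 <= e * 2 ^+ j.+1) is left h then ex_minn h else 0%N.

Definition prec e := (2 * first_bit e + 3)%N.

(** Truncating the digits of [e] and adding one to the quotient both err upwards, which puts the
    value strictly above [1 / e]. *)
Definition bsize e := (2 ^ prec e %/ Num.truncn (e * 2 ^+ prec e)).+1%N.

Lemma first_bitP e : 0 < e < 1 ->
  [/\ 1 <= e * 2 ^+ (first_bit e).+1, e * 2 ^+ first_bit e < 1
    & forall i, 1 <= e * 2 ^+ i.+1 -> (first_bit e <= i)%N].
Proof.
move=> /andP[e0 e1]; rewrite /first_bit; case: pselect => [h|[]]; last first.
  exists (Num.bound e^-1); rewrite -ler_pdivrMl // mulr1.
  by apply/ltW/upper_nthrootP; exact: leqnSn.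
case: ex_minnP => -[|j] hj minj; split=> //; first by rewrite expr0 mulr1.
by rewrite ltNge; apply/negP => /minj; rewrite ltnn.
Qed.

Lemma binary_digit_first_bit e : 0 < e < 1 -> binary_digit e (first_bit e).
Proof.
move=> e01; have [le lt _] := first_bitP e01.
rewrite /binary_digit (@truncn_def _ _ 1) // le /= exprS mulrCA.
by rewrite -[ltRHS]mulr1 ltr_pM2l // ltr0n.
Qed.

Lemma first_bit_min e i : 0 < e < 1 -> binary_digit e i -> (first_bit e <= i)%N.
Proof.
move=> e01; have [_ _ h] := first_bitP e01; rewrite /binary_digit => od.
by apply: h; rewrite -truncn_gt0; case: (Num.truncn _) od.
Qed.

(** Horner's scheme, by which the machine obtains the truncation from the digits. *)
Lemma truncn_digits e b : 0 < e < 1 ->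
  iteri b (fun i a => a + a + binary_digit e i)%N 0%N = Num.truncn (e * 2 ^+ b).
Proof.
move=> /andP[e0 e1]; elim: b => [|b IH] /=.
  by rewrite expr0 mulr1; apply/esym/truncn_def; rewrite ltW.
rewrite IH /binary_digit exprS mulrCA; set z := e * 2 ^+ b.
have z0 : 0 <= z by rewrite mulr_ge0 ?ltW // exprn_gt0.
have /andP[t1 t2] := truncn_itv z0; set t := Num.truncn z in t1 t2 *.
have [lt|ge] := ltP (2 * z) (t.*2.+1)%:R.
  rewrite (@truncn_def _ _ t.*2) ?odd_double ?addn0 ?addnn // lt andbT.
  by rewrite -mul2n natrM ler_pM2l ?ltr0n.
rewrite (@truncn_def _ _ t.*2.+1) ?ge /= ?odd_double ?addnn ?addn1 //.
by rewrite (_ : t.*2.+2 = 2 * t.+1)%N ?natrM ?ltr_pM2l ?ltr0n //; lia.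
Qed.

Section Estimates.
Variable e : R.
Hypothesis e01 : 0 < e < 1.

Let e0 : 0 < e. Proof. by case/andP: e01. Qed.
Let Q : R := 2 ^+ prec e.
Let F := Num.truncn (e * Q).

(** With [j] the first bit, the factor [2 ^ (j + 1)] lifts [e] to at least 1, and [j + 2] further
    digits remain. *)
Let F_ge : (2 ^ (first_bit e).+2 <= F)%N.
Proof.
have [le _ _] := first_bitP e01.
rewrite /F truncn_ge_nat; last by rewrite mulr_ge0 ?ltW // exprn_gt0.
rewrite natrX /Q /prec (_ : (2 * _ + 3)%N = ((first_bit e).+1 + (first_bit e).+2)%N).
  by rewrite exprD mulrA -[leLHS]mul1r ler_pM2r // exprn_gt0.
lia.
Qed.

Lemma truncn_prec_gt0 : (0 < Num.truncn (e * 2 ^+ prec e))%N.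
Proof. by apply: leq_trans F_ge; rewrite expn_gt0. Qed.

Lemma bsize_gt : 1 < (bsize e)%:R * e.
Proof.
have Q0 : 0 < Q by rewrite exprn_gt0.
have lt : (2 ^ prec e < bsize e * F)%N by apply: ltn_ceil; exact: truncn_prec_gt0.
rewrite -(ltr_pM2r Q0) mul1r -mulrA.
apply: (@lt_le_trans _ _ ((bsize e)%:R * F%:R)).
  by rewrite -natrM /Q -natrX ltr_nat.
by rewrite ler_pM2l ?ltr0n // truncn_le mulr_ge0 // ltW.
Qed.

(** With the quotient [u], [e * Q < F + 1] gives [u * e * Q <= Q + u], and [u <= e * Q] because
    [1 <= e * F], which is where the additional digits are used. *)
Lemma bsize_le : (bsize e)%:R * e <= 1 + 2 * e.
Proof.
have Q0 : 0 < Q by rewrite exprn_gt0.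
have [le _ _] := first_bitP e01.
pose u := (2 ^ prec e %/ F)%N.
have uF : u%:R * F%:R <= Q by rewrite /Q -natrX -natrM ler_nat leq_trunc_div.
have Flt : e * Q < F%:R + 1 by rewrite natr1; exact: truncnS_gt.
have F0 : 0 < F%:R :> R by rewrite ltr0n truncn_prec_gt0.
have eF : 1 <= e * F%:R.
  have : (2 : R) ^+ (first_bit e).+2 <= F%:R by rewrite -natrX ler_nat F_ge.
  rewrite exprS => h.
  have : e * (2 * 2 ^+ (first_bit e).+1) <= e * F%:R by rewrite ler_pM2l.
  by lra.
have uQ : u%:R <= e * Q.
  have : u%:R * 1 <= u%:R * (e * F%:R) by rewrite ler_wpM2l.
  have : e * (u%:R * F%:R) <= e * Q by rewrite ler_pM2l.
  lra.
have -> : (bsize e)%:R = u%:R + 1 :> R by rewrite /bsize -natr1.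
suff : u%:R * e <= 1 + e by lra.
rewrite -(ler_pM2r Q0).
have : u%:R * (e * Q) <= u%:R * (F%:R + 1) by rewrite ler_wpM2l // ltW.
lra.
Qed.

Lemma first_bit_lt_bsize : (2 ^ first_bit e < bsize e)%N.
Proof.
have [_ lt _] := first_bitP e01; rewrite -(ltr_nat R) natrX.
rewrite -(ltr_pM2l e0); apply: lt_trans lt _; rewrite mulrC; exact: bsize_gt.
Qed.

(** Keeps [2 ^ prec e] at most the number of vertices, hence within the bounds of the machine. *)
Lemma prec_le_vexp : (prec e <= vexp (bsize e))%N.
Proof.
have := first_bit_lt_bsize; have := ltn_expl (first_bit e) (isT : 1 < 2)%N.
rewrite /prec /vexp; move: (first_bit e) (bsize e) => j s; nia.
Qed.

End Estimates.
End BlockSize.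

(** In other words [k s <= n (1 / s - 1 / (s + 1))], as needed for [blocking_fhadwiger_le]. *)
Lemma blocks_leq_nverts s : (blocks s * s * (s * s.+1) <= nverts s)%N.
Proof.
have c := cube_leq_exp s.
have -> : nverts s = (blocks s * 2 ^ (3 * s))%N.
  by rewrite /nverts /blocks -expnD /vexp; congr (2 ^ _)%N; lia.
rewrite -mulnA leq_mul2l; apply/orP; right; apply: leq_trans c.
by rewrite !expnS expn0; nia.
Qed.

Lemma blocks_size_leq_nverts s : (blocks s * s <= nverts s)%N.
Proof.
case: s => [|s]; first by rewrite muln0.
by apply: leq_trans (blocks_leq_nverts s.+1); rewrite leq_pmulr.
Qed.

(** * The program that searches for the graph *)

Section Machine.
Variable R : realType.

Definition unit_interval := {e : R | 0 < e < 1}.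
Definition nv (x : unit_interval) := nverts (bsize (val x)).
(** Bounds the number of arrays, as [blocks s * s <= nverts s]; its powers are still negligible
    against [2 ^ (n ^ 2 / 2)]. *)
Definition size_bound (x : unit_interval) := (nv x ^ nv x)%N.
Definition ectx := memctx (fun x : unit_interval => binary_digit (val x)) size_bound.

(** The first [n * n] cells are reserved for the adjacency matrix. *)
Definition graph_mem (n : nat) (f : nat -> bool) q := f (n * n + q)%N.

Lemma nv_leq_size_bound x : (nv x <= size_bound x)%N.
Proof.
have n1 : (0 < nv x)%N by rewrite expn_gt0.
by rewrite /size_bound -{1}(expn1 (nv x)) leq_pexp2l.
Qed.

Lemma pbounded_nv (F : ectx -> nat) : (forall g, F g <= nv g.1)%N -> pbounded F.
Proof.
move=> le; apply: pbounded_le (@pbounded_bd ectx) => g.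
by apply: leq_trans (le g) _; apply: leq_trans (nv_leq_size_bound _) _.
Qed.

Lemma ptime_bsize : ptime (fun g : ectx => bsize (val g.1)).
Proof.
have e01 (g : ectx) : 0 < val g.1 < 1 by case: g => -[].
have le2 (g : ectx) b : (b <= vexp (bsize (val g.1)))%N -> (2 ^ b <= nv g.1)%N.
  by move=> h; rewrite /nv /nverts leq_exp2l.
have pfb : ptime (fun g : ectx => first_bit (val g.1)).
  apply: (@ptime_search _ (fun g : ectx => binary_digit (val g.1))).
  - exact: (@ptime_inp (ext ectx) _ (@ptime_var ectx)).
  - by move=> g; exact: binary_digit_first_bit.
  - by move=> g i; exact: first_bit_min.
  apply: pbounded_nv => g; apply: leq_trans (le2 g _ (prec_le_vexp (e01 g))).
  by apply: leq_trans (ltnW (ltn_expl (prec _) (isT : 1 < 2)%N)); rewrite /prec; lia.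
have pp : ptime (fun g : ectx => prec (val g.1)).
  apply: ptimeD; last exact: ptime_const.
  by apply: ptimeM => //; exact: ptime_const.
have bQ : pbounded (fun g : ectx => 2 ^ prec (val g.1))%N.
  by apply: pbounded_nv => g; apply: le2; exact: prec_le_vexp.
have pQ : ptime (fun g : ectx => 2 ^ prec (val g.1))%N.
  by apply: (@ptimeX _ (fun=> 2%N)) => //; exact: ptime_const.
have tr_le (g : ectx) b : (Num.truncn (val g.1 * 2 ^+ b) <= 2 ^ b)%N.
  rewrite -(ler_nat R) natrX; have /andP[e0 e1] := e01 g.
  have b0 : 0 <= (2 : R) ^+ b by rewrite exprn_ge0.
  apply: (@le_trans _ _ (val g.1 * 2 ^+ b)).
    by rewrite truncn_le mulr_ge0 // ltW.
  by rewrite -[leRHS]mul1r ler_wpM2r // ltW.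
have pF : ptime (fun g : ectx => Num.truncn (val g.1 * 2 ^+ prec (val g.1))).
  apply: (@ptime_ext ectx (fun g => iteri (prec (val g.1))
    (fun i a => a + a + binary_digit (val g.1) i)%N 0%N)) => [g|].
    exact: truncn_digits.
  apply: (@ptime_rec _ _ _ (fun g : ectx => 2 ^ prec (val g.1))%N) => //.
  - exact: ptime_const.
  - apply: ptimeD; first by apply: ptimeD; exact: ptime_var.
    by apply: (@ptime_inp (ext (ext ectx))); exact: (ptime_weak (@ptime_var _)).
  - move=> g i le; rewrite truncn_digits //; apply: leq_trans (tr_le g i) _.
    by rewrite leq_exp2l.
apply: ptimeS; apply: ptime_div => // g; exact: truncn_prec_gt0.
Qed.

Definition graph_bit (x : unit_interval) (f : nat -> bool) q :=
  (q %/ nv x != q %% nv x)%N &&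
  graph_mem (nv x) f (pair_index (q %/ nv x) (q %% nv x)).

Lemma graph_search : exists p K, forall (x : unit_interval) w0,
  (w0 < 2 ^ (nv x * nv x))%N ->
  check (nv x) (bsize (val x)) (blocks (bsize (val x))) (bit w0) ->
  exists w t s, [/\ check (nv x) (bsize (val x)) (blocks (bsize (val x))) (bit w),
    exec (binary_digit (val x)) p state0 t s,
    (t <= w0.+1 * (size_bound x).+3 ^ K)%N, reg s 0 = nv x
    & forall q, (q < nv x * nv x)%N ->
        cell s q = (q %/ nv x != q %% nv x)%N &&
          bit w (pair_index (q %/ nv x) (q %% nv x))].
Proof.
pose s (g : ectx) := bsize (val g.1).
have ps : ptime s by exact: ptime_bsize.
have c_ n : ptime (fun _ : ectx => n) by exact: ptime_const.
have n0 (g : ectx) : (0 < nv g.1)%N by rewrite expn_gt0.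
have pn : ptime (fun g : ectx => nv g.1).
  apply: (@ptimeX _ (fun=> 2%N)) => //; last exact: pbounded_nv.
  by apply: ptimeM; apply: ptimeD.
have pk : ptime (fun g : ectx => blocks (s g)).
  apply: (@ptimeX _ (fun=> 2%N)) => //.
    by apply: ptimeD; [exact: ptimeM | apply: ptimeD => //; exact: ptimeM].
  apply: pbounded_nv => g; rewrite /nv /nverts leq_exp2l // /vexp -/(s g).
  by move: (s g) => u; lia.
have pB : ptime (fun g : ectx => nv g.1 * nv g.1)%N by exact: ptimeM.
have pchk : ptime (fun g : ectx => check (nv g.1) (s g) (blocks (s g))
    (graph_mem (nv g.1) g.2)).
  apply: (@ptime_check ectx (fun g => nv g.1) s _ (fun g => nv g.1 * nv g.1)%N) => //.
  apply: pbounded_le (@pbounded_bd ectx) => g; apply: ltnW; rewrite ltnS.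
  by rewrite /size_bound leq_pexp2l // blocks_size_leq_nverts.
have pout : ptime (fun g : ext ectx => graph_bit g.1.1 g.1.2 g.2).
  have pn1 : ptime (fun g : ext ectx => nv g.1.1) := ptime_weak pn.
  have pv := @ptime_var ectx.
  have pd : ptime (fun g : ext ectx => g.2 %/ nv g.1.1)%N by exact: ptime_div.
  have pm : ptime (fun g : ext ectx => g.2 %% nv g.1.1)%N by exact: ptime_mod.
  apply: ptime_and; first by apply: ptime_neg; exact: ptime_eq.
  apply: (@ptime_mem (ext ectx)); apply: ptimeD; first exact: (ptime_weak pB).
  exact: ptime_pair_index.
have [|p [K h]] := @counter_search _ (fun x : unit_interval => binary_digit (val x))
  size_bound nv (fun x => nv x * nv x)%N
  (fun x f =>
     check (nv x) (bsize (val x)) (blocks (bsize (val x))) (graph_mem (nv x) f))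
  graph_bit pn pB pchk pout.
  by move=> x f f' q ff'; rewrite /graph_bit /graph_mem ff' // leq_addr.
have cE x w : graph_mem (nv x) (counter (fun x => nv x * nv x)%N x w) = bit w.
  by apply/funext => q; rewrite /graph_mem /counter leq_addr addKn.
exists p, K => x w0 w0n; rewrite -(cE x) => chk0.
have [w [t [st [chk ex tT rn cs]]]] := h x w0 w0n chk0.
exists w, t, st; split=> //; first by rewrite -(cE x).
by move=> q qn; rewrite cs // /graph_bit cE.
Qed.

End Machine.

(** * Asymptotic estimates and the theorem *)

Lemma cvg_at_right_linear (R : realType) (c : R) : c * e @[e --> 0^'+] --> (0 : R).
Proof.
apply: cvg_at_right_filter; have := @mulrl_continuous R c 0.
by rewrite /continuous_at mulr0; exact.
Qed.

Lemma sqr_leq_expn m : (m * m <= 2 * 2 ^ m)%N.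
Proof.
elim: m => // m IH; case: (leqP m 2) => [|m3]; first by case: m {IH} => [|[|[|]]].
by rewrite expnS; nia.
Qed.

(** Only the colours of pair numbers matter, and these lie below ['C(n, 2)]; this short encoding
    yields the exponent [n ^ 2 / 2] of the running time. *)
Lemma exists_checked s : (0 < s)%N ->
  exists2 w, (w < 2 ^ 'C(nverts s, 2).+1)%N & check (nverts s) s (blocks s) (bit w).
Proof.
move=> s0; have [f fP] := exists_balanced (union_bound s0).
have [w wlt wf] := exists_bits f 'C(nverts s, 2).+1.
exists w => //; apply/checkP; first by rewrite expn_gt0.
move=> g gn rd c; have [i [j [ij h]]] := fP g gn rd c.
exists i, j; split=> // a b al bl; have /andP[lij jk] := ij.
rewrite wf ?h // ltnW // ltnS; apply: ltn_pair_index; last exact: rd.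
  by apply: gn; apply: row_index_lt => //; exact: ltn_trans jk.
by apply: gn; exact: row_index_lt.
Qed.

Lemma bin2_leq_half n : (2 <= n)%N -> (2 * 'C(n, 2).+1 <= n * n)%N.
Proof.
move=> n2; have : (2 * 'C(n, 2) = n * n.-1)%N 
  by have := bin_ffact n 2; rewrite ffactnS ffactn1 => <-; rewrite mulnC.
by case: n n2 => [|[|n]] //= _ E; rewrite mulnS E; nia.
Qed.

(** The rounds account for the exponent [n ^ 2 / 2], and each costs at most [2 ^ (2 m n K)]. From
    [1 <= m e] and [m ^ 2 <= 2 n] follows [m <= 2 e n], so the additional exponent is at most
    [8 K e] times [n ^ 2 / 2]. *)
Lemma running_time (R : realType) (e : R) s K t w :
  0 < e -> 1 < s%:R * e -> (w < 2 ^ 'C(nverts s, 2).+1)%N ->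
  (t <= w.+1 * (nverts s ^ nverts s).+3 ^ K)%N ->
  t%:R <= 2 `^ ((1 + (8 * K)%:R * e) * ((nverts s)%:R ^+ 2 / 2)) :> R.
Proof.
move=> e0 se wlt tle; set n := nverts s in wlt tle *; set m := vexp s.
have nE : n = (2 ^ m)%N by [].
have m5 : (5 <= m)%N by rewrite /m /vexp; nia.
have n4 : (4 <= n)%N by rewrite nE (@leq_exp2l 2 2) // (leq_trans _ m5).
have n_gt0 : (0 < n)%N by exact: leq_trans n4.
have le1 : (t <= 2 ^ ('C(n, 2).+1 + 2 * (m * n) * K))%N.
  apply: leq_trans tle _; rewrite expnD; apply: leq_mul => //.
  (* For [z = n ^ n >= 4], [z + 3 <= z ^ 2]. *)
  rewrite [(2 ^ (_ * K))%N]expnM; case: (K) => // K'; rewrite leq_exp2r //.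
  rewrite mulnC expnM expnM -nE.
  have : (4 <= n ^ n)%N.
    by apply: leq_trans n4 _; rewrite -{1}(expn1 n) leq_pexp2l.
  by move: (n ^ n)%N => z; rewrite expnS expn1; nia.
apply: (@le_trans _ _ (2 ^ ('C(n, 2).+1 + 2 * (m * n) * K))%N%:R).
  by rewrite ler_nat.
rewrite natrX -powR_mulrn //; apply: ler_powR; first by rewrite ler1n.
rewrite natrD mulrDl mul1r; apply: lerD.
  rewrite ler_pdivlMr // -natrX -natrM ler_nat mulnC.
  by apply: bin2_leq_half; exact: leq_trans n4.
have nR : 0 < n%:R :> R by rewrite ltr0n; exact: leq_trans n4.
have mle : m%:R <= 2 * e * n%:R.
  have me : 1 <= m%:R * e.
    apply/ltW; apply: lt_le_trans se _; rewrite ler_pM2r // ler_nat /m /vexp; nia.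
  have h : m%:R * m%:R <= 2 * n%:R :> R by rewrite -!natrM ler_nat nE sqr_leq_expn.
  have m0 : 0 <= m%:R :> R by [].
  have : m%:R * 1 <= m%:R * (m%:R * e) by rewrite ler_wpM2l.
  have : e * (m%:R * m%:R) <= e * (2 * n%:R) by rewrite ler_wpM2l // ltW.
  lra.
have K0 : 0 <= K%:R :> R by [].
rewrite (natrM _ _ K) (natrM _ 2) (natrM _ m n) (natrM _ 8 K).
have : (n%:R * K%:R) * m%:R <= (n%:R * K%:R) * (2 * e * n%:R).
  by rewrite ler_wpM2l // mulr_ge0 // ltW.
rewrite expr2; move: (n%:R : R) (m%:R : R) (K%:R : R) => a b c; lra.
Qed.

Theorem theorem9 (R : realType) :
  exists (p : prog) (o1 o2 : R -> R),
    [/\ o1 e @[e --> 0^'+] --> (0 : R),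
        o2 e @[e --> 0^'+] --> (0 : R)
      & forall e : R, 0 < e < 1 ->
        exists (n0 : nat) (G : sgraph 'I_n0),
          [/\ n0%:R = 2 `^ ((1 + o1 e) * e ^- 2),
              exists2 t : nat, finds p e G t
                & t%:R <= 2 `^ ((1 + o2 e) * (n0%:R ^+ 2 / 2)),
              Num.max (fhadwiger R G) (fhadwiger R (compl G)) <= e * n0%:R
            & forall t : nat, (0 < t)%N ->
                [/\ eps_Hadwiger e (blowup G t),
                    eps_Hadwiger e (compl (blowup G t))
                  & eps_Hadwiger e (blowup (compl G) t)]]].
Proof.
have [p [K search]] := graph_search R.
(* The first error term makes [(1 + o1 e) / e ^ 2] equal to [vexp (bsize e)]; the second one is that
   of [running_time]. *)
exists p, (fun e => (vexp (bsize e))%:R * e ^+ 2 - 1), (fun e => (8 * K)%:R * e).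
split; [|exact: cvg_at_right_linear|].
  (* Since [1 < u <= 1 + 2 e] for [u = s e], the value [u ^ 2 + 6 u e + 5 e ^ 2 - 1] lies between 0
     and [10 e + 21 e ^ 2], which is at most [31 e]. *)
  apply: (squeeze_cvgr (f := fun=> 0) (h := fun e => 31 * e)).
  - near=> e; have e0 : 0 < e by near: e; exact: nbhs_right_gt.
    have e1 : e < 1 by near: e; exact: nbhs_right_lt.
    have e01 : 0 < e < 1 by rewrite e0.
    have lo := bsize_gt e01; have hi := bsize_le e01.
    rewrite /vexp natrM !natrD; move: (bsize e)%:R lo hi => s lo hi.
    set u := s * e in lo hi.
    have -> : (s + 1) * (s + 5) * e ^+ 2 - 1 = u * u + 6 * (u * e) + 5 * (e * e) - 1.
      by rewrite /u; ring.
    by apply/andP; split; nra.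
  - exact: cvg_cst.
  - exact: cvg_at_right_linear.
move=> e e01; have /andP[e0 e1] := e01.
pose x : unit_interval R := exist _ e e01.
have s0 : (0 < bsize e)%N by [].
have [w0 w0lt chk0] := exists_checked s0.
have n2 : (2 <= nv x)%N.
  by rewrite /nv /nverts (@leq_exp2l 2 1) // /vexp; lia.
have [|w [t [st [chk ex tle rn cs]]]] := search x w0 _ chk0.
  apply: leq_trans w0lt _; rewrite leq_exp2l //.
  by have := bin2_leq_half n2; rewrite /nv /=; lia.
have n0 : (0 < nv x)%N by exact: ltnW.
pose G := bit_graph (nv x) (bit w).
have [blk blkC] := check_blocking n0 chk.
have fh (H : sgraph 'I_(nv x)) :
    blocking (bsize e) (blocks (bsize e)) H -> fhadwiger R H <= e * (nv x)%:R.
  move=> bH; rewrite -[nv x in leRHS]card_ord.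
  apply: blocking_fhadwiger_le bH => //; rewrite card_ord.
  have s0R : 0 < (bsize e)%:R :> R by rewrite ltr0n.
  (* As [1 / s < e], the factor [e - 1 / (s + 1)] is at least [1 / (s (s + 1))]. *)
  apply: (@le_trans _ _ ((nv x)%:R * ((bsize e)%:R^-1 - (bsize e).+1%:R^-1))).
    have -> : (bsize e)%:R^-1 - (bsize e).+1%:R^-1
        = ((bsize e)%:R * (bsize e).+1%:R)^-1 :> R.
      by rewrite -natr1; field; rewrite natr1 !pnatr_eq0.
    rewrite ler_pdivlMr ?mulr_gt0 ?ltr0n // -!natrM ler_nat.
    exact: blocks_leq_nverts.
  rewrite ler_pM2l ?ltr0n // lerD2r -[leLHS]mul1r ler_pdivrMr //.
  by rewrite mulrC; apply/ltW/bsize_gt.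
(* The edges of each of the three graphs project to single vertices or to edges of [G], respectively
   of its complement. *)
have had (H : sgraph 'I_(nv x)) u (H' : sgraph ('I_(nv x) * 'I_u)%type) :
    (0 < u)%N -> fhadwiger R H <= e * (nv x)%:R ->
    (forall a b, H' a b -> (a.1 == b.1) || H a.1 b.1) -> eps_Hadwiger e H'.
  move=> u0 fH HH'; apply: le_trans (hadwiger_le_fhadwiger R u0 HH') _.
  by rewrite card_prod !card_ord natrM mulrA ler_pM2r ?ltr0n.
exists (nv x), G; split.
- rewrite addrCA subrr addr0 mulfK ?expf_neq0 ?gt_eqF //.
  by rewrite powR_mulrn // -natrX.
- exists t; last exact: running_time (bsize_gt e01) w0lt tle.
  exists st => //; split=> // i j.
  have ltij : (i * nv x + j < nv x * nv x)%N by exact: row_index_lt.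
  rewrite cs // divnMDl // divn_small // addn0 modnMDl modn_small //.
- by rewrite ge_max !fh.
- move=> u u0; split.
  + apply: (had G) => //; first exact: fh.
    by move=> a b /orP[->|/andP[->]] //; rewrite orbT.
  + apply: (had (compl G)) => //; first exact: fh.
    move=> a b /andP[ab]; rewrite /= /blowup_edge negb_or => /andP[nG _].
    by rewrite /compl_edge nG andbT orbN.
  + apply: (had (compl G)) => //; first exact: fh.
    by move=> a b /orP[->|/andP[->]] //; rewrite orbT.
Unshelve. all: by end_near.
Qed.
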